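(* Let $I \subset \mathbb{R}$ be a compact interval, $A \subset I$ a finite subset and $n \in \mathbb{N}$. Suppose that $f$ is an analytic function such that for any collection of $n$ distinct real numbers $0<\delta_1,\dots, \delta_n < \mathrm{diam}(I)$, the functions $$\Delta_{\delta_i}f(x)\coloneqq f(x+\delta_i)-f(x), \quad 1 \leq i \leq n,$$ are 1-independent. Then $$|2^nf(A-A)-(2^{n}-1)f(A-A)|\gg_{f,n,I} |A|^{1+\phi(n)},$$ where $\phi:\mathbb{N} \to \mathbb{R}$ is given by $\phi(1)=1$ and $\phi(n)=1+\frac{1}{1+\frac{1}{\phi(n-1)}}$ for $n\geq 2$.
   Context: $A-A=\{a-a':a,a'\in A\}$. For finite $B \subset \mathbb{R}$ and positive integers $s,t$, $sB - tB$ denotes the set of all $b_1+\dots+b_s - b_1'-\dots-b_t'$ with all $b_i, b_j' \in B$. $f$ is a real analytic function on an open interval containing the relevant domain (in particular $f$ is defined on $I$ and on $A-A$). A set of analytic functions $\{g_1,\dots,g_n\}$ is called 1-independent if the derivatives $g_1',\dots,g_n'$ are linearly independent over $\mathbb{R}$. $X \gg_{z} Y$ means $X \geq C(z)\, Y$ for some positive constant $C(z)$ depending only on $z$. *)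

(* Defs.v *)
From mathcomp Require Import all_boot all_order all_algebra finmap.
From mathcomp Require Import all_classical all_reals all_analysis.

Set Implicit Arguments.
Unset Strict Implicit.
Unset Printing Implicit Defensive.

Import Order.TTheory GRing.Theory Num.Theory.
Import numFieldNormedType.Exports.

Local Open Scope classical_set_scope.
Local Open Scope ring_scope.

Section defs.
Variable R : realType.
Implicit Types (f : R -> R) (D E : set R) (A B : {fset R}).

(* Convergence at every point of a neighborhood of x0 forces a positive radius
   of convergence. *)
Definition analytic_on D f : Prop :=
  forall x0, D x0 -> exists c : R^nat,
    \forall x \near x0, pseries c (x - x0) @ \oo --> f x.

Definition diam E : R := sup [set `|x - y| | x in E & y in E].

Definition Delta (d : R) f : R -> R := fun x => f (x + d) - f x.

(* Functions are total in Rocq: D is the set on which the g i are considered,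
   that is, on which the linear relation between the derivatives has to hold. *)
Definition one_independent D (n : nat) (g : 'I_n -> R -> R) : Prop :=
  forall c : 'I_n -> R,
    (forall x, D x -> \sum_(i < n) c i * derive1 (g i) x = 0) ->
    forall i, c i = 0.

(* The common domain of the Delta (d i) f when f is given on J. *)
Definition Delta_dom (J : set R) (n : nat) (d : 'I_n -> R) : set R :=
  [set x | J x /\ forall i, J (x + d i)].

Definition diffset A : {fset R} := [fset a - a' | a in A, a' in A]%fset.

(* sB - tB; tuples of elements of B, so repetitions are allowed. *)
Definition sumdiff (s t : nat) B : {fset R} :=
  [fset \sum_(i < s) fsval (tnth b i) - \sum_(j < t) fsval (tnth b' j)
    | b : s.-tuple B, b' : t.-tuple B]%fset.

(* The recursion starts at n = 1; the value at 0 is a placeholder. *)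
Fixpoint phi (n : nat) : R :=
  match n with
  | 0%N => 0
  | 1%N => 1
  | (_.+1 as m).+1 => 1 + 1 / (1 + 1 / phi m)
  end.

End defs.

Arguments phi R n : clear implicits.

(* Main.v *)
Require Import Defs.
From mathcomp Require Import all_boot all_order all_algebra finmap.
From mathcomp Require Import all_classical all_reals all_analysis.
From mathcomp Require Import perm ring lra zify.

(* By pigeonhole we may assume that A lies in a short interval, so that only
   the values of f on some (0, r) matter.  If one of the Hankel determinants
   det (f^(2+i+j))_{i,j<k}, k <= n, vanished identically near 0, then f'' would
   satisfy a linear differential equation of order < n with constant
   coefficients; for n shifts d_i some nontrivial combination of the Delta_{d_i} f'
   would then vanish to infinite order at a point, contradicting 1-independence.
   By analyticity these determinants are therefore nonzero on some (0, r), and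
   the Wronskian criterion for Chebyshev systems, applied in both variables,
   shows that the determinants of (1, Delta_{d_1} f, ..., Delta_{d_k} f) at
   increasing points have a sign depending only on k.

   For a family g_1, ..., g_n with this sign property on N points, one of the
   sets 2^(n-1) g_i - (2^(n-1)-1) g_i has at least c N^phi(n) elements between
   the extreme values of g_i, by induction on n.  Group the gaps between
   consecutive values of g_1 by size.  If most gaps belong to large groups, then
   on each group the increments of g_2, ..., g_n form again such a family, with
   n - 1 functions, and the elements found for them are squeezed into the gaps
   of g_i.  Otherwise there are many distinct gap sizes, and the small gaps are
   squeezed into the large ones in 2 g_1 - g_1.  The two cases balance at group
   size N^(1/(1+phi(n-1))).

   Finally f(a_(i+j) - a) - f(a_i - a), 1 <= j <= n, as functions of a, form such
   a family for every i; the elements found are squeezed into the intervals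
   between f(a_i - a') and f(a_(i+n) - a') for a fixed a'. *)

Set Implicit Arguments.
Unset Strict Implicit.
Unset Printing Implicit Defensive.

Import Order.TTheory GRing.Theory Num.Theory.
Import numFieldNormedType.Exports.

Local Open Scope ring_scope.

(** * Signs of leading minors *)

Section LeadingMinors.
Variable R : realFieldType.
Implicit Types (M v w : nat -> nat -> R) (k m : nat).

(** Matrices are arrays indexed by [nat], so that the size can change in an induction without casts
    between ordinals. *)
Definition ldet k M : R := \det (\matrix_(i < k, j < k) M i j).

Lemma eq_ldet k M M' :
  (forall i j, (i < k)%N -> (j < k)%N -> M i j = M' i j) -> ldet k M = ldet k M'.
Proof. by move=> e; congr (\det _); apply/matrixP => i j; rewrite !mxE e. Qed.

Lemma ldet_tr k M : ldet k (fun i j => M j i) = ldet k M.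
Proof. by rewrite /ldet -det_tr; congr (\det _); apply/matrixP => i j; rewrite !mxE. Qed.

Lemma ldet1 M : ldet 1 M = M 0 0.
Proof. by rewrite /ldet det_mx11 mxE. Qed.

Lemma ldet_scale_cols k M (s : nat -> R) :
  ldet k (fun i j => s j * M i j) = (\prod_(j < k) s j) * ldet k M.
Proof.
rewrite /ldet [RHS]mulrC -(mulr1 (\prod_(j < k) s j)).
have -> : \matrix_(i < k, j < k) (s j * M i j) =
   (\matrix_(i < k, j < k) M i j) *m diag_mx (\row_(j < k) s j).
  apply/matrixP => i j; rewrite mul_mx_diag !mxE; exact: mulrC.
rewrite det_mulmx det_diag mulr1; congr (_ * _).
by apply: eq_bigr => i _; rewrite mxE.
Qed.

Lemma ldet_scale k M (s : R) : ldet k (fun i j => s * M i j) = s ^+ k * ldet k M.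
Proof. by rewrite (ldet_scale_cols k M (fun=> s)) prodr_const card_ord. Qed.

Definition setcol m (c : nat -> R) M i j := if j == m then c i else M i j.

(** Cofactor expansion along column [m]: the cofactors do not see that column, so the same [a]
    serves every [c]. *)
Lemma ldet_setcol k m M : (m < k)%N ->
  exists a : nat -> R, forall c, ldet k (setcol m c M) = \sum_(i < k) c i * a i.
Proof.
move=> mk; pose j0 := Ordinal mk.
pose A := \matrix_(i < k, j < k) M i j.
exists (fun i => if insub i is Some i' then cofactor A i' j0 else 0) => c.
rewrite /ldet (expand_det_col _ j0); apply: eq_bigr => i _.
rewrite valK !mxE /setcol eqxx; congr (_ * _).
rewrite /cofactor; congr (_ * \det _); apply/matrixP => p q; rewrite !mxE.
by rewrite -[m]/(j0 : nat) (inj_eq val_inj) eq_sym (negPf (neq_lift _ _)).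
Qed.

(* Subtracting from each column its predecessor turns the row of ones into a
   unit vector. *)
Lemma ldet_ones k M : (forall j, (j <= k)%N -> M 0 j = 1) ->
  ldet k.+1 M = ldet k (fun i j => M i.+1 j.+1 - M i.+1 j).
Proof.
move=> M1.
pose A := \matrix_(i < k.+1, j < k.+1) M i j.
pose U := \matrix_(i < k.+1, j < k.+1)
  ((i == j)%:R - (i.+1 == j :> nat)%:R : R).
have dU : \det U = 1.
  rewrite -det_tr det_trig; first by rewrite big1 // => i _; rewrite !mxE eqxx gtn_eqF // subr0.
  apply/is_trig_mxP => i j ij; rewrite !mxE -(inj_eq val_inj) /= !gtn_eqF ?subrr //.
  exact: ltnW.
rewrite /ldet -/A -[\det A]mulr1 -dU -det_mulmx.
have AU (i j : 'I_k.+1) : (A *m U) i j = M i j - (if (j : nat) is j'.+1 then M i j' else 0).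
  rewrite !mxE; transitivity (\sum_(l < k.+1) (M i l * (l == j)%:R - M i l * (l.+1 == j :> nat)%:R)).
    by apply: eq_bigr => l _; rewrite !mxE mulrBr.
  rewrite sumrB; congr (_ - _).
    rewrite (bigD1 j) //= eqxx mulr1 big1 ?addr0 // => l /negPf ->; exact: mulr0.
  case: j => -[|j] hj /=; first by rewrite big1 // => l _; rewrite mulr0.
  have hj' : (j < k.+1)%N by lia.
  rewrite (bigD1 (Ordinal hj')) //= eqxx mulr1 big1 ?addr0 // => l.
  by rewrite -(inj_eq val_inj) /= eqSS => /negPf ->; rewrite mulr0.
rewrite (expand_det_row _ ord0) big_ord_recl big1 ?addr0 => [|j _]; last first.
  by rewrite AU /= !M1 ?subrr ?mul0r // /bump; case: j => /=; lia.
rewrite AU /= subr0 M1 // mul1r /cofactor /= addn0 expr0 mul1r.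
congr (\det _); apply/matrixP => i j; rewrite [LHS]mxE [LHS]mxE AU !mxE /=.
by rewrite /bump /= !add1n.
Qed.

(** The determinant is a linear functional of each single column. The first hypothesis says that a
    functional positive on all sample columns [v ^~ t] with [P j t] is positive on column [j] of
    [w]; hence the sample columns can be exchanged for those of [w] one after the other. Columns
    that are sums of samples, and increments controlled by the mean value theorem, are the two
    instances. *)
Lemma ldet_expand_pos (T : Type) (P : nat -> T -> Prop) (v : nat -> T -> R)
    (w : nat -> nat -> R) (e : R) k :
  (forall a : nat -> R, forall j, (j < k)%N ->
    (forall t, P j t -> 0 < \sum_(i < k) v i t * a i) ->
    0 < \sum_(i < k) w i j * a i) ->
  (forall p : nat -> T, (forall j, (j < k)%N -> P j (p j)) ->
     0 < e * ldet k (fun i j => v i (p j))) ->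
  (exists p : nat -> T, forall j, (j < k)%N -> P j (p j)) ->
  0 < e * ldet k w.
Proof.
move=> H pos [p0 Pp0].
(* Induction on the number [m] of columns already exchanged; the samples [p] stay arbitrary, since
   the next exchange varies one of them. *)
suff : forall m, (m <= k)%N -> forall p, (forall j, (j < k)%N -> P j (p j)) ->
    0 < e * ldet k (fun i j => if (j < m)%N then w i j else v i (p j)).
  move=> /(_ k (leqnn k) p0 Pp0).
  by rewrite (@eq_ldet _ _ w) // => i j _ ->.
elim=> [_ p Pp|m IH mk p Pp].
  by rewrite (@eq_ldet _ _ (fun i j => v i (p j))) //; exact: pos.
set M := fun i j : nat => _.
have [a ha] := ldet_setcol M mk.
have -> : ldet k M = ldet k (setcol m (w^~ m) M).
  by apply: eq_ldet => i j _ _; rewrite /setcol /M; case: eqP => // ->; rewrite leqnn.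
rewrite ha mulr_sumr.
under eq_bigr do rewrite mulrCA.
apply: (H (fun i => e * a i)) => // t Pt.
have -> : \sum_(i < k) v i t * (e * a i) = e * ldet k (setcol m (v^~ t) M).
  by rewrite ha mulr_sumr; apply: eq_bigr => i _; rewrite mulrCA.
have := IH (ltnW mk) (fun j => if j == m then t else p j).
rewrite (@eq_ldet _ _ (setcol m (v^~ t) M)).
  by apply=> j jk; case: eqP => [->//|_]; exact: Pp.
move=> i j _ _; rewrite /setcol /M [(j < m.+1)%N]ltnS [(j <= m)%N]leq_eqVlt; case: eqP => [->|] //=.
by rewrite ltnn.
Qed.

Lemma ldet_sum_gt0 (v : nat -> nat -> R) (e : R) k (a b : nat -> nat) :
  (forall j, (j < k)%N -> (a j < b j)%N) ->
  (forall p : nat -> nat, (forall j, (j < k)%N -> (a j <= p j < b j)%N) ->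
     0 < e * ldet k (fun i j => v i (p j))) ->
  0 < e * ldet k (fun i j => \sum_(a j <= t < b j) v i t).
Proof.
move=> ab pos; apply: (@ldet_expand_pos _ (fun j t => (a j <= t < b j)%N) v) => //.
- move=> c j jk cpos.
  under eq_bigr do rewrite mulr_suml.
  rewrite exchange_big /= big_ltn ?ab // ltr_wpDr ?cpos ?leqnn ?ab //.
  rewrite big_seq sumr_ge0 // => t; rewrite mem_index_iota => /andP[at_ tb].
  by apply/ltW/cpos; rewrite tb (ltnW at_).
- by exists a => j jk; rewrite leqnn ab.
Qed.

Lemma prod_scale_gt0 k (s : R) (d : nat -> R) :
  (forall j, (j < k)%N -> 0 < s * d j) -> 0 < s ^+ k * \prod_(j < k) d j.
Proof.
move=> sd; have -> : s ^+ k = \prod_(j < k) s by rewrite prodr_const card_ord.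
by rewrite -big_split prodr_gt0 // => j _; exact: sd.
Qed.

(* The two determinants differ by the factor [\prod_j v 0 j], which has the
   sign of [s ^+ k.+1]. *)
Lemma ldet_quotient_sign k (v : nat -> nat -> R) (e s : R) :
  (forall j, (j <= k)%N -> 0 < s * v 0 j) ->
  (0 < e * ldet k.+1 v) = (0 < e * s ^+ k.+1 *
     ldet k (fun i j => v i.+1 j.+1 / v 0 j.+1 - v i.+1 j / v 0 j)).
Proof.
move=> v0.
have v0n j : (j <= k)%N -> v 0 j != 0.
  by move=> jk; have := v0 _ jk; case: eqP => // ->; rewrite mulr0 ltxx.
have -> : ldet k.+1 v = (\prod_(j < k.+1) v 0 j) *
    ldet k.+1 (fun i j => v i j / v 0 j).
  rewrite -ldet_scale_cols; apply: eq_ldet => i j _; rewrite ltnS => jk.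
  by rewrite mulrC divfK ?v0n.
rewrite ldet_ones => [|j jk]; last by rewrite divff ?v0n.
set D := ldet k _.
have sk : s ^+ k.+1 != 0.
  by rewrite expf_neq0 //; have := v0 _ (leqnn k); case: eqP => // ->; rewrite mul0r ltxx.
have pp := prod_scale_gt0 (v0 : forall j, (j < k.+1)%N -> _).
have s2 : 0 < s ^+ k.+1 ^+ 2 by rewrite exprn_even_gt0.
rewrite -(pmulr_rgt0 _ s2).
have -> : s ^+ k.+1 ^+ 2 * (e * (\prod_(j < k.+1) v 0 j * D)) =
  (s ^+ k.+1 * \prod_(j < k.+1) v 0 j) * (e * s ^+ k.+1 * D) by ring.
by rewrite pmulr_rgt0.
Qed.

(** Fekete's criterion: the signs of the minors on consecutive columns determine those on arbitrary
    columns. By induction on [n], divide by the first row and take differences of neighbouring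
    columns. Consecutive minors of the new array come from consecutive minors of [v] with one more
    row, while a difference between distant columns is a sum of neighbouring ones, which
    [ldet_sum_gt0] handles. *)
Lemma fekete_minors_gt0 n N (v : nat -> nat -> R) (e : nat -> R) :
  (forall k j, (0 < k <= n)%N -> (j + k <= N)%N ->
     0 < e k * ldet k (fun i l => v i (j + l)%N)) ->
  forall k p, (0 < k <= n)%N -> (forall i j, (i < j < k)%N -> (p i < p j)%N) ->
    (forall i, (i < k)%N -> (p i < N)%N) ->
    0 < e k * ldet k (fun i l => v i (p l)).
Proof.
elim: n N v e => [|n IH] N v e cons k p; first by case: k.
case: k => // k kn pincr pN.
have v0 j : (j < N)%N -> 0 < e 1 * v 0 j.
  by move=> jN; have := cons 1 j isT; rewrite ldet1 addn0 addn1; apply.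
pose w i j := v i j / v 0 j.
rewrite (@ldet_quotient_sign _ _ _ (e 1)); last by move=> j jk; rewrite v0 ?pN.
case: k kn pincr pN => [|k] kn pincr pN.
  rewrite /ldet det_mx00 mulr1 expr1 -expr2 exprn_even_gt0 //=.
  by have := v0 _ (pN 0 isT); case: eqP => // ->; rewrite mul0r ltxx.
rewrite (@eq_ldet _ _ (fun i l => \sum_(p l <= t < p l.+1) (w i.+1 t.+1 - w i.+1 t))); last first.
  move=> i j ik jk; rewrite telescope_sumr //.
  by apply/ltnW/pincr; rewrite ltnSn ltnS.
apply: (@ldet_sum_gt0 (fun i t => w i.+1 t.+1 - w i.+1 t)) => [j jk|q pq].
  by rewrite pincr // ltnSn ltnS.
(* The new sign sequence absorbs the factor by which [ldet_quotient_sign] changes the sign. *)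
apply: (IH N.-1 (fun i t => w i.+1 t.+1 - w i.+1 t) (fun k => e k.+1 * e 1 ^+ k.+1)) => //.
- move=> k0 j /andP[k0_gt0 k0n] jk.
  have := cons k0.+1 j; rewrite (@ldet_quotient_sign _ _ _ (e 1)); last first.
    by move=> l lk; apply: v0; lia.
  rewrite (@eq_ldet _ _ (fun i l => w i.+1 (j + l).+1 - w i.+1 (j + l)%N)).
    by apply; lia.
  by move=> i l _ _; rewrite addnS.
- move=> i j /andP[ij jk]; have /andP[_ h1] := pq i (ltn_trans ij jk).
  have /andP[h2 _] := pq j jk; rewrite (leq_trans h1) // (leq_trans _ h2) //.
  case: (ltngtP i.+1 j) ij => // [ij _|->//].
  by apply/ltnW/pincr; rewrite ij ltnS ltnW.
- move=> i ik; have /andP[_ h1] := pq i ik.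
  have := pN i.+1; rewrite ltnS => /(_ ik); lia.
Qed.

End LeadingMinors.

(** * Sums of differences and squeezing *)

Section Representations.
Variable R : realType.
Implicit Types (X Y : R -> Prop) (m : nat) (z w : R).

(** This is membership in $(m+1)X - mX$, the surplus being always one summand. *)
Definition rep m X z := exists p q : seq R,
  [/\ size p = m.+1, size q = m, (forall x, x \in p -> X x),
      (forall x, x \in q -> X x) & z = \sum_(x <- p) x - \sum_(x <- q) x].

Lemma rep_sub m X Y z : (forall x, X x -> Y x) -> rep m X z -> rep m Y z.
Proof.
move=> XY [p [q [sp sq Xp Xq ->]]]; exists p, q.
by split=> // x /[dup] _; [move/Xp/XY|move/Xq/XY].
Qed.

Lemma rep0 X z : X z -> rep 0 X z.
Proof.
move=> Xz; exists [:: z], [::]; split=> //; last by rewrite big_seq1 big_nil subr0.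
by move=> x; rewrite inE => /eqP ->.
Qed.

Lemma repN m X z : rep m X z -> rep m (fun x => X (- x)) (- z).
Proof.
move=> [p [q [sp sq Xp Xq ->]]].
exists (map -%R p), (map -%R q); rewrite !size_map !big_map !sumrN; split=> //.
- by move=> x /mapP[y yp ->]; rewrite opprK; exact: Xp.
- by move=> x /mapP[y yp ->]; rewrite opprK; exact: Xq.
- by rewrite opprD opprK.
Qed.

Lemma rep_pad m m' X x z : X x -> (m <= m')%N -> rep m X z -> rep m' X z.
Proof.
move=> Xx mm [p [q [sp sq Xp Xq ->]]].
exists (nseq (m' - m) x ++ p), (nseq (m' - m) x ++ q).
rewrite !size_cat !size_nseq sp sq !big_cat /=; split; [lia|lia| | |].
- by move=> y; rewrite mem_cat mem_nseq => /orP[/andP[_ /eqP ->]//|/Xp].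
- by move=> y; rewrite mem_cat mem_nseq => /orP[/andP[_ /eqP ->]//|/Xq].
- by rewrite opprD addrACA subrr add0r.
Qed.

Lemma split_differences X Y (p : seq R) :
  (forall x, X x -> exists y y', [/\ Y y, Y y' & x = y - y']) ->
  (forall x, x \in p -> X x) ->
  exists p1 p2 : seq R, [/\ size p1 = size p, size p2 = size p,
    (forall x, x \in p1 -> Y x), (forall x, x \in p2 -> Y x) &
    \sum_(x <- p) x = \sum_(x <- p1) x - \sum_(x <- p2) x].
Proof.
move=> XY; elim: p => [_|x p IH Xp].
  by exists [::], [::]; split=> //; rewrite !big_nil subr0.
have [|p1 [p2 [s1 s2 Y1 Y2 e]]] := IH.
  by move=> y yp; apply: Xp; rewrite inE yp orbT.
have [|y [y' [Yy Yy' xe]]] := XY x; first by apply: Xp; rewrite mem_head.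
exists (y :: p1), (y' :: p2); rewrite /= s1 s2 !big_cons e xe; split=> //.
- by move=> u; rewrite inE => /orP[/eqP ->//|/Y1].
- by move=> u; rewrite inE => /orP[/eqP ->//|/Y2].
- by rewrite opprD addrACA.
Qed.

(** Replacing the $2m+1$ summands by differences gives $2m+1$ terms of each sign, and [w] supplies
    the surplus one. The passage from $m+1$ to $2(m+1)$ positive terms is the source of the powers
    of two. *)
Lemma rep_difference m X Y w z :
  (forall x, X x -> exists y y', [/\ Y y, Y y' & x = y - y']) -> Y w ->
  rep m X z -> rep (m.*2.+1) Y (w + z).
Proof.
move=> XY Yw [p [q [sp sq Xp Xq ->]]].
have [p1 [p2 [s1 s2 Y1 Y2 ->]]] := split_differences XY Xp.
have [q1 [q2 [t1 t2 Z1 Z2 ->]]] := split_differences XY Xq.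
exists (w :: p1 ++ q2), (p2 ++ q1).
rewrite /= !size_cat s1 s2 t1 t2 sp sq big_cons !big_cat /=; split; [lia|lia| | |].
- by move=> x; rewrite inE mem_cat => /or3P[/eqP ->|/Y1|/Z2].
- by move=> x; rewrite mem_cat => /orP[/Y2|/Z1].
- by ring.
Qed.

Lemma uniq_squeeze N (g : nat -> R) (Z : nat -> seq R) :
  (forall j, (j < N)%N -> g j <= g j.+1) ->
  (forall j, (j < N)%N -> uniq (Z j)) ->
  (forall j z, (j < N)%N -> z \in Z j -> g j < z <= g j.+1) ->
  uniq (flatten [seq Z j | j <- iota 0 N]).
Proof.
move=> g_mono Zu Zb.
(* The upper bound [g N] is carried along because it separates the earlier sets from the next one,
   whose elements exceed [g N]. *)
suff [//] : uniq (flatten [seq Z j | j <- iota 0 N]) /\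
   forall z, z \in flatten [seq Z j | j <- iota 0 N] -> z <= g N.
elim: N g_mono Zu Zb => [|N IH] g_mono Zu Zb; first by [].
have [|||u b] := IH.
- by move=> j jN; apply: g_mono; exact: ltnW.
- by move=> j jN; apply: Zu; exact: ltnW.
- by move=> j z jN; apply: Zb; exact: ltnW.
rewrite -addn1 iotaD map_cat flatten_cat /= cats0 add0n addn1 cat_uniq u Zu ?ltnSn //; split.
  rewrite andbT; apply/hasPn => z /Zb; rewrite ltnSn => /(_ isT)/andP[gz _].
  by apply/negP => /b; rewrite leNgt gz.
move=> z; rewrite mem_cat => /orP[/b h|/Zb]; first by rewrite (le_trans h) ?g_mono.
by rewrite ltnSn => /(_ isT)/andP[].
Qed.

End Representations.

(** * Sign-regular families *)

Section SignRegular.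
Variable R : realType.
Implicit Types (g h : nat -> nat -> R) (e : nat -> R) (n N k : nat).

(* By [ldet_ones] these are the minors of [1, g 0, ..., g n.-1] containing
   the row of ones. *)
Definition sign_regular n N g e := forall k (rho kappa : nat -> nat),
  (0 < k)%N -> (forall i j, (i < j < k)%N -> (rho i < rho j)%N) ->
  (forall i, (i < k)%N -> (rho i < n)%N) ->
  (forall i j, (i < j <= k)%N -> (kappa i < kappa j)%N) -> (kappa k < N)%N ->
  0 < e k * ldet k (fun i l => g (rho i) (kappa l.+1) - g (rho i) (kappa l)).

Lemma sign_regular_opp n N g e : sign_regular n N g e ->
  sign_regular n N (fun i j => - g i j) (fun k => (-1) ^+ k * e k).
Proof.
move=> reg k rho kappa k0 h1 h2 h3 h4.
rewrite (@eq_ldet _ _ _ (fun i l => -1 * (g (rho i) (kappa l.+1) - g (rho i) (kappa l)))); last first.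
  by move=> i l _ _; rewrite mulN1r opprB opprK addrC.
rewrite ldet_scale [_ * e k]mulrC mulrA -[e k * _ * _]mulrA -expr2 sqrr_sign mulr1.
exact: reg.
Qed.

Lemma sign_regular_window n N r o g e : sign_regular n N g e -> (o + r <= N)%N ->
  sign_regular n r (fun i j => g i (o + j)%N) e.
Proof.
move=> reg orN k rho kappa k0 h1 h2 h3 h4.
apply: (reg k rho (fun i => (o + kappa i)%N)) => //; last by lia.
by move=> i j ij; rewrite ltn_add2l; exact: h3.
Qed.

Lemma sign_regular_increments n N g e i j j' : sign_regular n N g e ->
  (i < n)%N -> (j < j' < N)%N -> 0 < e 1%N * (g i j' - g i j).
Proof.
move=> reg i_n /andP[jj' j'N].
have := reg 1%N (fun=> i) (fun l => if l is 0 then j else j') isT.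
rewrite ldet1; apply=> //.
- by move=> a b; lia.
- by move=> [|a] [|b] //; lia.
Qed.

Lemma sign_regular_increasing n N g e i j j' : sign_regular n N g e ->
  0 < e 1%N -> (i < n)%N -> (j < j' < N)%N -> g i j < g i j'.
Proof.
move=> reg e1 i_n jj'; have := sign_regular_increments reg i_n jj'.
by rewrite pmulr_rgt0 // subr_gt0.
Qed.

(* On columns where the first function has the same increment [d], the row of
   these increments plays the role of the row of ones. *)
Lemma sign_regular_equal_gaps n N r g e (s : nat -> nat) d :
  sign_regular n.+1 N g e ->
  (forall i j, (i < j < r)%N -> (s i < s j)%N) ->
  (forall i, (i < r)%N -> ((s i).+1 < N)%N) ->
  (forall i, (i < r)%N -> g 0 (s i).+1 - g 0 (s i) = d) ->
  sign_regular n r (fun i j => g i.+1 (s j).+1 - g i.+1 (s j)) (fun k => e k.+1 * d).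
Proof.
move=> reg s_incr sN gap k rho kappa k0 rho_incr rho_n kappa_incr kappa_r.
have kr j : (j <= k)%N -> (kappa j < r)%N.
  rewrite leq_eqVlt => /orP[/eqP ->//|jk]; apply: ltn_trans kappa_r.
  by apply: kappa_incr; rewrite jk leqnn.
pose rho' i := if i is i'.+1 then (rho i').+1 else 0%N.
pose h i j := g i (s j).+1 - g i (s j).
pose M i j := if i is i'.+1 then h (rho i').+1 (kappa j) else 1.
rewrite -[ldet k _](@ldet_ones _ k M) // -mulrA.
(* Multiplying the row of ones by [d] yields the row of increments of [g 0]; the transpositions turn
   this into a scaling of a column. *)
have -> : d * ldet k.+1 M = ldet k.+1 (fun i l => h (rho' i) (kappa l)).
  rewrite -ldet_tr -[RHS]ldet_tr.
  transitivity (ldet k.+1 (fun i j => (if j == 0%N then d else 1) * M j i)).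
    by rewrite ldet_scale_cols big_ord_recl big1 ?mulr1.

  apply: eq_ldet => i [|j] ik jk /=; last by rewrite mul1r.
  by rewrite mulr1 /h gap // kr.
have rho'_incr m a b : (m <= k.+1)%N -> (a < b < m)%N -> (rho' a < rho' b)%N.
  case: a b => [|a] [|b] //= mk abm; rewrite ltnS; apply: rho_incr; lia.
have rho'_n m a : (m <= k.+1)%N -> (a < m)%N -> (rho' a < n.+1)%N.
  by case: a => //= a mk am; rewrite ltnS rho_n //; lia.
(* The columns [s (kappa l)] are scattered, whereas sign regularity speaks of increments over
   adjoining intervals, that is, of consecutive columns of the array of increments. Fekete's
   criterion bridges the two. *)
apply: (@fekete_minors_gt0 _ k.+1 N.-1 (fun i j => g (rho' i) j.+1 - g (rho' i) j) e _ _ (fun l => s (kappa l))).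
- move=> m j /andP[m0 mk] jm.
  rewrite (@eq_ldet _ _ _ (fun i l => g (rho' i) (j + l.+1)%N - g (rho' i) (j + l)%N)).
    apply: (reg m rho' (addn j)) => //; [ | | |lia].
    + by move=> a b; exact: rho'_incr.
    + by move=> a; exact: rho'_n.
    + by move=> a b; lia.
  by move=> i l _ _; rewrite addnS.
- by rewrite leqnn.
- by move=> i j ijk; apply: s_incr; rewrite kr ?kappa_incr //; lia.
- by move=> i ik; have := sN (kappa i) (kr i _); lia.
Qed.

End SignRegular.

(** * The growth property, its base case, and its use on half of the columns *)

Section Growth.
Variable R : realType.
Implicit Types (g h : nat -> nat -> R) (e : nat -> R) (n N k : nat).

Definition values (u : nat -> R) N (x : R) := exists2 j, (j < N)%N & x = u j.

(** The condition on [e 1] makes every [g i] increasing. The index [i] is existential because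
    pigeonholing selects it. The location between the extreme values is what allows the elements to
    be squeezed into gaps later. *)
Definition growth n (c : R) := forall N g e, (0 < N)%N ->
  sign_regular n N g e -> 0 < e 1%N ->
  exists i (Z : seq R), [/\ (i < n)%N, uniq Z,
    c * N%:R `^ phi R n <= (size Z)%:R &
    forall z, z \in Z -> rep (2 ^ n.-1).-1 (values (g i) N) z /\
       g i 0%N <= z <= g i N.-1].

Lemma phi_ge1 n : 1 <= phi R n.+1.
Proof.
elim: n => [|n IH]; first exact: lexx.
have p0 : 0 < phi R n.+1 by exact: lt_le_trans IH.
rewrite -[phi R n.+2]/(1 + 1 / (1 + 1 / phi R n.+1)) lerDl divr_ge0 //.
by rewrite addr_ge0 // divr_ge0 // ltW.
Qed.

Lemma phiE n : phi R n.+2 = 1 + phi R n.+1 / (1 + phi R n.+1).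
Proof.
have p0 : 0 < phi R n.+1 by exact: lt_le_trans (phi_ge1 n).
rewrite -[phi R n.+2]/(1 + 1 / (1 + 1 / phi R n.+1)); field.
by rewrite !gt_eqF // addr_gt0.
Qed.

Lemma growth1 : growth 1 1.
Proof.
move=> N g e N0 reg e1; exists 0%N, [seq g 0%N j | j <- iota 0 N].
have g_incr j j' : (j < j' < N)%N -> g 0%N j < g 0%N j'.
  exact: (sign_regular_increasing reg).
have g_le j j' : (j <= j')%N -> (j' < N)%N -> g 0%N j <= g 0%N j'.
  rewrite leq_eqVlt => /orP[/eqP ->//|jj'] j'N.
  by rewrite ltW // g_incr ?jj'.
split=> //.
- rewrite map_inj_in_uniq ?iota_uniq // => j j'; rewrite !mem_iota /= add0n => jN j'N.
  case: (ltngtP j j') => // jj' eg.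
    by have := @g_incr j j'; rewrite eg ltxx jj' j'N => /(_ isT).
  by have := @g_incr j' j; rewrite eg ltxx jj' jN => /(_ isT).
- by rewrite size_map size_iota mul1r powRr1.
- move=> z /mapP[j]; rewrite mem_iota /= add0n => jN ->; split.
    by apply: rep0; exists j.
  by rewrite !g_le //; lia.
Qed.

(* The values found on one half of the columns do not exceed the increments
   [h i l] for [l] in the other half. *)
Lemma growth_half n c r h e : (0 < n)%N -> growth n c -> (0 < r)%N ->
  sign_regular n r h e ->
  (forall i l, (i < n)%N -> (l < r)%N -> 0 < h i l) ->
  exists i (Z : seq R) lo len, [/\ (i < n)%N, uniq Z,
    c * (uphalf r)%:R `^ phi R n <= (size Z)%:R,
    [/\ (lo + len <= r)%N, (r <= len.*2)%N & (lo <= r./2 < lo + len)%N] &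
    forall l z, (lo <= l < lo + len)%N -> z \in Z ->
      rep (2 ^ n.-1).-1 (values (h i) r) z /\ 0 < z <= h i l].
Proof.
move=> n0 gr r0 reg0 h0.
(* With a single column sign regularity is vacuous and any [e'] will do; with two columns an
   increment of nonzero sign excludes [e 1 = 0]. *)
have [{reg0}e' reg e'0] : exists2 e', sign_regular n r h e' & e' 1%N != 0.
  have [r1|r1] := ltnP r 2.
    exists (fun=> 1); last exact: oner_neq0.
    move=> k rho kappa k0 _ _ /(_ 0%N k); rewrite k0 leqnn => /(_ isT).
    by move: (kappa 0%N) (kappa k); lia.
  exists e => //; have := sign_regular_increments reg0 n0 (_ : (0 < 1 < r)%N).
  by rewrite r1 => /(_ isT); case: eqP => // ->; rewrite mul0r ltxx.
move: {e}e' reg e'0 => e reg; set q := uphalf r.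
have q0 : (0 < q)%N by rewrite /q; lia.
have qr : (q <= r)%N by rewrite /q; lia.
have reg' o : (o + q <= r)%N -> sign_regular n q (fun i j => h i (o + j)%N) e.
  exact: sign_regular_window.
have rep_window o i m z : (o + q <= r)%N ->
    rep m (values (fun j => h i (o + j)%N) q) z -> rep m (values (h i) r) z.
  by move=> oq; apply: rep_sub => _ [j jq ->]; exists (o + j)%N; first lia.
case: (ltrgt0P (e 1%N)) => // e1 _.
(* Increasing case: the elements come from the first [q] columns, so they are at most [h i q.-1],
   hence at most [h i l] for every later [l]. *)
- have [i [Z [i_n uZ sZ Zr]]] := gr q _ e q0 (reg' 0%N qr) e1.
  exists i, Z, q.-1, (r - q).+1; split=> //; first by split; rewrite /q; lia.
  move=> l z ll /Zr[rz /andP[z1 z2]]; split; first exact: rep_window rz.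
  rewrite (lt_le_trans _ z1) ?h0 //= (le_trans z2) // add0n.
  case: (ltngtP q.-1 l) ll => [ql ll|ql|->//]; last by lia.
  by rewrite ltW // (sign_regular_increasing reg) // ql; lia.
(* Decreasing case: negating the last [q] columns gives an increasing family. Its elements are at
   least [- h i (r - q)], so after a second negation they are at most [h i l] for [l <= r - q]. *)
- have regN : sign_regular n q (fun i j => - h i (r - q + j)%N) (fun k => (-1) ^+ k * e k).
    by apply/sign_regular_opp/reg'; lia.
  have [|i [Z [i_n uZ sZ Zr]]] := gr q _ _ q0 regN.
    by rewrite expr1 mulN1r oppr_gt0.
  exists i, (map -%R Z), 0%N, (r - q).+1; split=> //.
  + by rewrite map_inj_uniq //; exact: oppr_inj.
  + by rewrite size_map.
  + by split; rewrite /q; lia.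
  move=> l _ ll /mapP[z /Zr[rz /andP[z1 z2]] ->]; split.
    apply: (rep_window (r - q)%N); first by lia.
    by move/repN: rz; apply: rep_sub => x [j jq xj]; exists j => //; apply: oppr_inj.
  rewrite oppr_gt0 (le_lt_trans z2) ?oppr_lt0 ?h0 //=; last by lia.
  rewrite lerNl; apply: le_trans z1; rewrite lerN2 addn0.
  case: (ltngtP l (r - q)%N) ll => [ql ll|ql|->//]; last by lia.
  have := sign_regular_increments reg i_n (_ : (l < r - q < r)%N).
  by rewrite ql nmulr_rgt0 // subr_lt0 => /(_ _)/ltW; apply; lia.
Qed.

End Growth.

(** * The growth estimate for sign-regular families *)

Section Counting.
Variables (T K : eqType) (key : T -> K).
Implicit Types (L : seq T) (D : seq K) (P Q : pred T).

Lemma count_by_key L D P : uniq D -> (forall x, x \in L -> key x \in D) ->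
  count P L = (\sum_(d <- D) count (fun x => (key x == d) && P x) L)%N.
Proof.
move=> uD; elim: L => [_|x L IH LD] /=; first by rewrite big1.
rewrite big_split /= -IH => [|y yL]; last by apply: LD; rewrite inE yL orbT.
congr addn; have xD := LD x (mem_head _ _).
rewrite (bigD1_seq (key x)) //= eqxx /= big1 ?addn0 // => d.
by rewrite eq_sym => /negPf ->.
Qed.

(** The predicate [p] depends only on the key, so each class is kept or dropped as a whole and the
    bound for single classes can be summed. *)
Lemma count_half_classes L (p : pred K) Q :
  (forall d, (count (fun x => key x == d) L <=
              (count (fun x => (key x == d) && Q x) L).*2)%N) ->
  (count (fun x => p (key x)) L <= (count (fun x => p (key x) && Q x) L).*2)%N.
Proof.
move=> half; pose D := undup (map key L).
have LD x : x \in L -> key x \in D by move=> xL; rewrite mem_undup map_f.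
rewrite !(@count_by_key L D) ?undup_uniq // -muln2 big_distrl /=.
apply: leq_sum => d _; case pd: (p d).
  apply: leq_trans (leq_trans (half d) _); last rewrite -muln2 leq_mul2r /=.
    by apply: sub_count => x /andP[].
  by apply: sub_count => x /= /andP[/eqP -> ->]; rewrite eqxx pd.
rewrite (@eq_count _ _ pred0) ?count_pred0 // => x /=.
by apply/andP => -[/eqP ->]; rewrite pd.
Qed.

End Counting.

Lemma count_pigeonhole (T : eqType) (f : T -> nat) (L : seq T) P k : (0 < k)%N ->
  (forall x, x \in L -> f x < k)%N ->
  exists2 i, (i < k)%N & (count P L <= k * count (fun x => (f x == i) && P x) L)%N.
Proof.
move=> k0 fk; apply: contrapT => H.
have {}H i : (i < k)%N -> (k * count (fun x => (f x == i) && P x) L < count P L)%N.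
  by move=> ik; rewrite ltnNge; apply/negP => h; apply: H; exists i.
have : (k * count P L < k * count P L)%N; last by rewrite ltnn.
rewrite {1}(@count_by_key _ _ f L (iota 0 k)) ?iota_uniq //; last first.
  by move=> x /fk; rewrite mem_iota.
rewrite big_distrr /=.
have -> : (k * count P L = \sum_(i <- iota 0 k) count P L)%N.
  by rewrite big_const_seq count_predT size_iota iter_addn_0 mulnC.
rewrite -{1 3}(subn0 k) -/(index_iota 0 k) !big_mkord.
rewrite (bigD1 (Ordinal k0)) //= [ltnRHS](bigD1 (Ordinal k0)) //=.
by rewrite -addSn leq_add ?H // leq_sum // => i _; rewrite ltnW ?H.
Qed.

Section CountingReal.
Variable R : realType.

(** Each gap value is taken at most [lambda] times on [C], so [lambda] times the rank of [gap j]
    among the distinct values bounds the number of [j'] in [C] with [gap j' <= gap j]. Summed over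
    [j], this number counts at least half of all pairs. *)
Lemma sum_rank_ge (gap : nat -> R) (L C : seq nat) (lambda : R) :
  (forall j, j \in C -> j \in L) -> 0 <= lambda ->
  (forall j, j \in C -> (count (fun j' => gap j' == gap j) C)%:R <= lambda) ->
  (size C)%:R ^+ 2 <= 2 * lambda *
    \sum_(j <- C) (count (fun d => d <= gap j) (undup (map gap L)))%:R.
Proof.
move=> CL l0 mult; set D := undup _.
have CD j : j \in C -> gap j \in D by move=> jC; rewrite mem_undup map_f // CL.
have step j : (count (fun j' => gap j' <= gap j) C)%:R <= lambda * (count (fun d => d <= gap j) D)%:R.
  rewrite (@count_by_key _ _ gap C D) ?undup_uniq // -sum1_count !natr_sum mulr_sumr.
  rewrite [leRHS]big_mkcond /=; apply: ler_sum => d _.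
  case: ifP => dj; last first.
    rewrite (@eq_count _ _ pred0) ?count_pred0 // => x /=.
    by apply/andP => -[/eqP ->]; rewrite dj.
  rewrite mulr1.
  have [[j' j'C j'd]|nod] := pselect (exists2 j', j' \in C & gap j' = d).
    apply: le_trans (mult j' j'C); rewrite ler_nat.
    by apply: sub_count => x /= /andP[/eqP -> _]; rewrite j'd.
  rewrite (@eq_in_count _ _ pred0) ?count_pred0 // => x xC /=.
  by apply/andP => -[/eqP xd _]; apply: nod; exists x.
rewrite -mulrA mulr_sumr.
apply: le_trans (_ : 2 * \sum_(j <- C) (count (fun j' => gap j' <= gap j) C)%:R <= _); last first.
  by rewrite ler_pM2l //; apply: ler_sum => j _; exact: step.
pose S := (\sum_(j <- C) \sum_(j' <- C) ((gap j' <= gap j)%R : nat))%N.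
(* Of the pairs [(j, j')] and [(j', j)] at least one is counted, so adding the two forms of [S]
   gives at least one per pair. *)
have SE : S = (\sum_(j <- C) \sum_(j' <- C) ((gap j <= gap j')%R : nat))%N by rewrite /S exchange_big.
have -> : \sum_(j <- C) (count (fun j' => gap j' <= gap j) C)%:R = S%:R :> R.
  rewrite natr_sum; apply: eq_bigr => j _; congr (_%:R).
  by rewrite -sum1_count big_mkcond /=; apply: eq_bigr => j' _; case: (_ <= _).
rewrite -natrX -natrM ler_nat mul2n -addnn {2}SE -big_split /=.
have -> : (size C ^ 2 = \sum_(j <- C) \sum_(j' <- C) 1)%N.
  by rewrite !sum1_size big_const_seq count_predT iter_addn_0 mulnn.
apply: leq_sum => j _; rewrite -big_split /=; apply: leq_sum => j' _.
by have := le_total (gap j') (gap j); case: (gap j' <= _) => //= ->.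
Qed.

End CountingReal.

Section GrowthStep.
Variable R : realType.
Implicit Types (g h : nat -> nat -> R) (e : nat -> R) (n N k : nat).

Lemma increasing_squeeze M (u : nat -> R) (Z : nat -> seq R) (X : R -> Prop) :
  (forall j, (j < M)%N -> u j <= u j.+1) ->
  (forall j, (j < M)%N -> uniq (Z j)) ->
  (forall j z, (j < M)%N -> z \in Z j -> X z /\ u j < z <= u j.+1) ->
  exists Z', [/\ uniq Z', (size Z' = \sum_(j <- iota 0 M) size (Z j))%N &
     forall z, z \in Z' -> X z /\ u 0%N <= z <= u M].
Proof.
move=> u_le Zu Zb.
have u_mono i j : (i <= j <= M)%N -> u i <= u j.
  elim: j => [|j IH]; first by rewrite leqn0 => /andP[/eqP ->].
  move=> /andP[]; rewrite leq_eqVlt => /orP[/eqP ->//|ij] jM.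
  by rewrite (le_trans (IH _)) ?u_le //; lia.
exists (flatten [seq Z j | j <- iota 0 M]); split.
- by apply: (uniq_squeeze (g := u)) => // j z jM /(Zb _ _ jM)[].
- by rewrite size_flatten /shape -map_comp sumnE big_map.
move=> z /flattenP[s /mapP[j]]; rewrite mem_iota /= add0n => jM -> zZ.
have [Xz /andP[z1 z2]] := Zb j z jM zZ; split=> //.
rewrite (le_trans _ (ltW z1)) ?(le_trans z2) // u_mono //; lia.
Qed.

(** The choice $l = M^{1/(1+p)}$ balances the yields of the two cases of the induction step, $M l^p$
    for large classes and $M^2/l$ for small ones. By [phiE] the common exponent is the next value of
    [phi]. *)
Lemma threshold_powers (M p : R) : 0 < M -> 0 < p ->
  exists2 l, 0 < l & M * l `^ p = M `^ (1 + p / (1 + p)) /\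
                     M ^+ 2 / l = M `^ (1 + p / (1 + p)).
Proof.
move=> M0 p0; exists (M `^ (1 + p)^-1); first exact: powR_gt0.
have p1 : 1 + p != 0 by rewrite gt_eqF // addr_gt0.
have MM a : M * M `^ a = M `^ (1 + a).
  by rewrite powRD ?powRr1 ?(ltW M0) //; apply/implyP => _; rewrite gt_eqF.
have MV : (M `^ (1 + p)^-1)^-1 = M `^ (- (1 + p)^-1) by rewrite powRN.
split; first by rewrite -powRrM MM mulrC.
rewrite MV expr2 -mulrA !MM; congr (_ `^ _).
by field.
Qed.

Lemma leq_uphalf_double k : (k <= uphalf k * 2)%N.
Proof. lia. Qed.

Lemma pred_expn2S n : (2 ^ n.+1).-1 = ((2 ^ n).-1).*2.+1.
Proof.
by rewrite expnS mul2n; case: (2 ^ n)%N (expn_gt0 2 n) => // m _; rewrite doubleS.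
Qed.

Lemma growth_step n (c : R) : 0 < c -> growth n.+1 c ->
  exists2 c' : R, 0 < c' & growth n.+2 c'.
Proof.
move=> c0 gr; set p := phi R n.+1; set P := phi R n.+2.
have p0 : 0 < p by apply: lt_le_trans (phi_ge1 R n).
have PE : P = 1 + p / (1 + p) by exact: phiE.
have P0 : 0 <= P by apply: le_trans (phi_ge1 R n.+1).
(* In [c1] the factor 1/4 accounts for large classes covering half of the gaps and good positions
   half of those, [n.+1] for the pigeonhole on the function, and $2^{-p}$ for working on half of a
   class. The 1/8 in [c2] belongs to small classes. The final constant pays for replacing [M.+1] by
   [2 * M], and the minimum with 1 covers [M = 0]. *)
pose c1 := c * (2^-1 `^ p) / 4 / n.+1%:R : R.
have c10 : 0 < c1 by rewrite !mulr_gt0 ?invr_gt0 ?powR_gt0 ?ltr0n.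
pose c2 := Num.min c1 8^-1 : R.
have c20 : 0 < c2 by rewrite lt_min c10 invr_gt0 ltr0n.
have two0 : 0 < 2 `^ P :> R by rewrite powR_gt0.
exists (Num.min 1 (c2 / 2 `^ P)); first by rewrite lt_min ltr01 divr_gt0.
move=> N g e N0 reg e1.
have g_incr i j j' : (i < n.+2)%N -> (j < j' < N)%N -> g i j < g i j'.
  exact: (sign_regular_increasing reg).
case: N N0 reg g_incr => // M _ reg g_incr.
have [->|M0] := posnP M.
  exists 0%N, [:: g 0%N 0%N]; split=> //.
    by rewrite powR1 mulr1 ge_min lexx.
  move=> z; rewrite inE => /eqP ->; rewrite lexx; split=> //.
  have v0 : values (g 0%N) 1 (g 0%N 0%N) by exists 0%N.
  by apply: rep_pad v0 _ (rep0 v0).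
have MR : 0 < M%:R :> R by rewrite ltr0n.
(* Common end of both cases: sets [Z j] placed in the successive gaps of one [g i] are disjoint, so
   only their total size has to be bounded. *)
have enough i (Z : nat -> seq R) m : (i < n.+2)%N -> (m <= (2 ^ n.+1).-1)%N ->
    (forall j, (j < M)%N -> uniq (Z j)) ->
    (forall j z, (j < M)%N -> z \in Z j ->
       rep m (values (g i) M.+1) z /\ g i j < z <= g i j.+1) ->
    c2 * M%:R `^ P <= (\sum_(j <- iota 0 M) size (Z j))%:R ->
    exists i (Z : seq R), [/\ (i < n.+2)%N, uniq Z,
    Num.min 1 (c2 / 2 `^ P) * M.+1%:R `^ P <= (size Z)%:R &
    forall z, z \in Z -> rep (2 ^ n.+1).-1 (values (g i) M.+1) z /\
       g i 0%N <= z <= g i M].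
  move=> i_n mn Zu Zb Zs.
  have [| | |Z' [uZ' sZ' Zb']] := @increasing_squeeze M (g i) Z
      (rep (2 ^ n.+1).-1 (values (g i) M.+1)).
  - by move=> j jM; rewrite ltW // g_incr // ltnSn.
  - exact: Zu.
  - move=> j z jM /(Zb j z jM)[rz zb]; split=> //.
    by apply: rep_pad rz => //; exists 0%N.
  exists i, Z'; split=> //; rewrite sZ'; apply: le_trans Zs.
  apply: le_trans (_ : c2 / 2 `^ P * (2 * M%:R) `^ P <= _).
    apply: ler_pM; rewrite ?powR_ge0 // ?ge_min ?lexx ?orbT //.
      by rewrite le_min ler01 divr_ge0 // ltW.
    by rewrite ge0_ler_powR ?nnegrE ?mulr_ge0 // -natrM ler_nat; lia.
  by rewrite powRM ?ler0n // mulrA divfK // gt_eqF.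
pose gap j := g 0%N j.+1 - g 0%N j.
have gap0 j : (j < M)%N -> 0 < gap j by move=> jM; rewrite subr_gt0 g_incr // ltnSn.
pose cls (d : R) := [seq j <- iota 0 M | gap j == d].
pose r (d : R) := size (cls d).
have [l l0 [lM Ml]] := threshold_powers MR p0.
have clsP d j : (j < r d)%N -> (nth 0%N (cls d) j < M)%N /\ gap (nth 0%N (cls d) j) = d.
  move=> jr; have := mem_nth 0%N jr; rewrite mem_filter mem_iota /= add0n.
  by move=> /andP[/eqP -> ->].
have cls_incr d i j : (i < j < r d)%N -> (nth 0%N (cls d) i < nth 0%N (cls d) j)%N.
  move=> /andP[ij jr]; apply: (sorted_ltn_nth ltn_trans) => //.
  - exact/sorted_filter/iota_ltn_sorted/ltn_trans.
  - by rewrite inE (ltn_trans ij).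
(* A tuple [x] consists of a function index, the set found on the class of [d], and the start and
   length of the range of positions in that class whose gaps can hold this set. *)
pose Q (d : R) (x : nat * seq R * nat * nat) :=
  [/\ (x.1.1.1 < n.+1)%N, uniq x.1.1.2,
    c * (uphalf (r d))%:R `^ p <= (size x.1.1.2)%:R,
    (x.1.2 + x.2 <= r d <= x.2.*2)%N &
    forall j z, (j < M)%N -> gap j = d -> (x.1.2 <= index j (cls d) < x.1.2 + x.2)%N ->
      z \in x.1.1.2 ->
        rep (2 ^ n.+1).-1 (values (g x.1.1.1.+1) M.+1) (g x.1.1.1.+1 j + z) /\
        0 < z <= g x.1.1.1.+1 j.+1 - g x.1.1.1.+1 j].
have /choice[F HF] : forall d, exists x, (0 < r d)%N -> Q d x.
  move=> d.
  have [_|r0] := posnP (r d); first by exists (0%N, [::], 0%N, 0%N).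
  (* On one class the gaps of [g 0] all equal [d], so the increments of the other [n.+1] functions
     are sign regular and the induction hypothesis applies to them. *)
  have regd := sign_regular_equal_gaps reg (@cls_incr d)
    (fun i ir => proj1 (clsP d i ir)) (fun i ir => proj2 (clsP d i ir)).
  have [|i [Z [lo [len [i_n uZ Zs [lolen rlen _] Zb]]]]] := growth_half (ltn0Sn n) gr r0 regd.
    move=> i j i_n jr; rewrite subr_gt0 g_incr ?ltnSn //=.
    by have [] := clsP d j jr.
  exists (i, Z, lo, len) => _; split=> //; first by rewrite lolen.
  move=> j z jM gj idx zZ.
  have jd : j \in cls d by rewrite mem_filter gj eqxx mem_iota.
  have [rz] := Zb _ _ idx zZ; rewrite nth_index // => zb; split=> //.
  (* The elements found are combinations of increments of [g i.+1]; translating by the base value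
     [g i.+1 j] yields combinations of values, at the price of doubling. *)
  rewrite pred_expn2S; apply: rep_difference rz; last by exists j => //; rewrite ltnS ltnW.
  move=> x [l0' l0r ->]; have [sM _] := clsP d l0' l0r.
  exists (g i.+1 (nth 0%N (cls d) l0').+1), (g i.+1 (nth 0%N (cls d) l0')).
  by split=> //; [exists (nth 0%N (cls d) l0').+1|exists (nth 0%N (cls d) l0') => //; rewrite ltnS ltnW].
pose good j := let d := gap j in
  ((F d).1.2 <= index j (cls d) < (F d).1.2 + (F d).2)%N.
have r_gap j : (j < M)%N -> (0 < r (gap j))%N.
  by move=> jM; rewrite /r size_filter -has_count; apply/hasP; exists j; rewrite ?mem_iota ?eqxx.
have good_half d : (count (fun j => gap j == d) (iota 0 M) <=
    (count (fun j => (gap j == d) && good j) (iota 0 M)).*2)%N.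
  rewrite -size_filter -/(cls d) -/(r d).
  have [->//|r0] := posnP (r d).
  have [_ _ _ /andP[lolen rlen] _] := HF d r0.
  apply: (leq_trans rlen); rewrite leq_double -size_filter.
  set lo := (F d).1.2; set len := (F d).2.
  rewrite -[len](size_iota lo) -(size_map (nth 0%N (cls d))).
  have uc : uniq (cls d) by rewrite filter_uniq // iota_uniq.
  have in_r t : t \in iota lo len -> (t < r d)%N.
    by rewrite mem_iota => /andP[_ h]; apply: leq_trans lolen.
  apply: uniq_leq_size.
    rewrite map_inj_in_uniq ?iota_uniq // => t t' /in_r tr /in_r tr' /eqP.
    by rewrite nth_uniq // => /eqP.
  move=> _ /mapP[t tt' ->]; have [jM jd] := clsP d t (in_r _ tt').
  rewrite mem_filter jd eqxx mem_iota jM andbT /= /good jd index_uniq //.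
    by rewrite andbT -mem_iota.
  exact: in_r.
pose big_class j := l <= (r (gap j))%:R.
have FP j : (j < M)%N -> Q (gap j) (F (gap j)) by move=> jM; apply/HF/r_gap.
have [large|small] := leqP M (count big_class (iota 0 M)).*2.
(* Different classes may favour different functions, but the squeezing takes place in the gaps of a
   single one; the most frequent index is kept. *)
- have [|i i_n count_i] := @count_pigeonhole _ (fun j => (F (gap j)).1.1.1)
    (iota 0 M) big_class _ (ltn0Sn n).
    by move=> j; rewrite mem_iota => /FP[].
  have := count_half_classes (fun d => ((F d).1.1.1 == i) && (l <= (r d)%:R)) good_half.
  set k := count _ _; set k' := count _ _ => kk'.
  have Mk' : M%:R <= 4 * n.+1%:R * k'%:R :> R.
    rewrite -!natrM ler_nat.
    apply: (leq_trans large); apply: leq_trans (_ : (n.+1 * k'.*2).*2 <= _)%N.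
      by rewrite leq_double (leq_trans count_i) // leq_mul2l kk' orbT.
    by rewrite -!muln2; clear; lia.
  pose Z j := if ((F (gap j)).1.1.1 == i) && good j
    then [seq g i.+1 j + z | z <- (F (gap j)).1.1.2] else [::].
  apply: (enough i.+1 Z _ _ (leqnn _)) => //.
  + move=> j /FP[_ uZ _ _ _]; rewrite /Z; case: ifP => // _.
    by rewrite map_inj_uniq //; exact: addrI.
  + move=> j x jM; rewrite /Z; case: ifP => // /andP[/eqP Fi gj] /mapP[z zF ->].
    have [_ _ _ _ /(_ j z jM erefl gj zF)] := FP j jM.
    by rewrite Fi => -[rz /andP[z0 zle]]; split=> //; rewrite ltrDl z0 -lerBrDl.
  + apply: le_trans (_ : k'%:R * (c * (l / 2) `^ p) <= _).
      rewrite powRM ?invr_ge0 ?(ltW l0) // PE -lM.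
      apply: le_trans (_ : c1 * (M%:R * l `^ p) <= _).
        by rewrite ler_wpM2r ?ge_min ?lexx // mulr_ge0 ?powR_ge0 ?ler0n.
      have := Mk'; rewrite mulrC -ler_pdivrMr ?mulr_gt0 ?ltr0n // => h.
      have -> : c1 * (M%:R * l `^ p) =
          M%:R / (4 * n.+1%:R) * (c * (l `^ p * 2^-1 `^ p)).
        by rewrite /c1; field; rewrite gt_eqF // -natr1 -natrD ltr0n; lia.
      by rewrite ler_wpM2r // !mulr_ge0 ?powR_ge0 // ltW.
    rewrite /k' -sum1_count natr_sum mulr_suml natr_sum big_mkcond /=.
    rewrite big_seq [leRHS]big_seq; apply: ler_sum => j; rewrite mem_iota /= add0n => jM.
    case: ifP => // /andP[/andP[Fi lr] gj]; rewrite /Z Fi gj /= size_map mul1r.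
    have [_ _ Zs _ _] := FP j jM; apply: le_trans Zs.
    rewrite ler_pM2l // ge0_ler_powR ?nnegrE ?(ltW p0) ?divr_ge0 ?(ltW l0) //.
    by rewrite ler_pdivrMr // (le_trans lr) // -natrM ler_nat leq_uphalf_double.
- pose C := [seq j <- iota 0 M | ~~ big_class j].
  have MC : (M <= (size C).*2)%N.
    have := count_predC big_class (iota 0 M).
    rewrite size_iota /C size_filter -[count [eta predC _] _]/(count (predC big_class) (iota 0 M)).
    by move: small; clear; lia.
  pose D := undup [seq gap j | j <- iota 0 M].
  (* Every distinct gap size not exceeding [gap j] fits above [g 0 j], and the resulting points lie
     in $2g_0 - g_0$. *)
  pose Z j := [seq g 0%N j + d | d <- [seq d <- D | d <= gap j]].
  have DP d : d \in D -> exists2 j, (j < M)%N & d = gap j.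
    by rewrite mem_undup => /mapP[j]; rewrite mem_iota => jM ->; exists j.
  apply: (enough 0%N Z 1%N) => //.
  + by rewrite pred_expn2S.
  + by move=> j _; rewrite map_inj_uniq ?filter_uniq ?undup_uniq //; exact: addrI.
  + move=> j x jM /mapP[d]; rewrite mem_filter => /andP[dj /DP[j' j'M dE]] ->.
    split; last by rewrite ltrDl dE gap0 //= -lerBrDl -dE.
    apply: (@rep_difference _ 0 (eq d)) (rep0 _); [|by exists j => //; rewrite ltnS ltnW|by []].
    move=> _ <-; exists (g 0%N j'.+1), (g 0%N j'); split=> //.
      by exists j'.+1.
    by exists j' => //; rewrite ltnS ltnW.
  + have rank := @sum_rank_ge _ gap (iota 0 M) C l _ (ltW l0) _.
    apply: le_trans (_ : \sum_(j <- C) (count (fun d => d <= gap j) D)%:R <= _); last first.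
      rewrite natr_sum big_filter [leLHS]big_mkcond /=.
      apply: ler_sum => j _; case: ifP => _; last exact: ler0n.
      by rewrite size_map size_filter.
    set S := \sum_(j <- C) _.
    have CS : (size C)%:R ^+ 2 <= 2 * l * S.
      apply: rank => j; rewrite mem_filter => /andP[// small_j _].
      move: small_j; rewrite -ltNge => /ltW; apply: le_trans.
      rewrite ler_nat /r size_filter /C count_filter; apply: sub_count => x.
      by case/andP.
    apply: le_trans (_ : 8^-1 * M%:R `^ P <= _).
      by rewrite ler_wpM2r ?powR_ge0 // ge_min lexx orbT.
    rewrite PE -Ml mulrA ler_pdivrMr // [8^-1 * _]mulrC ler_pdivrMr //.
    have : M%:R <= 2 * (size C)%:R :> R by rewrite -natrM ler_nat mul2n.
    rewrite -(@ler_pXn2r _ 2) ?nnegrE ?mulr_ge0 ?ler0n // => /le_trans; apply.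
    rewrite exprMn; move: CS; move: (_ ^+ 2) => u CS; lra.
Qed.

End GrowthStep.

(** * Functions with a sign-regular kernel *)

Section OrderedGrowth.
Variable R : realType.
Implicit Types (f : R -> R) (e : nat -> R) (n N k : nat).

Lemma growth_exists n : exists2 c : R, 0 < c & growth n.+1 c.
Proof.
elim: n => [|n [c c0 gr]]; first by exists 1 => //; exact: growth1.
exact: growth_step gr.
Qed.

(** The array pairs [k] shifts with [k.+1] points, and its entries are mixed second differences of
    [f]. The bound on [x k + d k.-1], the largest argument, keeps all arguments inside [(0, r)]. *)
Definition sign_regular_kernel n (r : R) f e := forall k (d x : nat -> R),
  (0 < k <= n)%N -> (forall i j, (i < j < k)%N -> d i < d j) -> 0 < d 0%N ->
  (forall i j, (i < j <= k)%N -> x i < x j) -> 0 < x 0%N -> x k + d k.-1 < r ->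
  0 < e k * ldet k (fun i l =>
    f (x l.+1 + d i) - f (x l.+1) - (f (x l + d i) - f (x l))).

Lemma increasing_ge_id k (rho : nat -> nat) :
  (forall i j, (i < j < k)%N -> (rho i < rho j)%N) ->
  forall i, (i < k)%N -> (i <= rho i)%N.
Proof.
move=> rho_incr; elim=> // i IH ik; apply: leq_ltn_trans (IH (ltnW ik)) _.
by apply: rho_incr; rewrite ltnSn.
Qed.

Lemma ordered_growth n : exists2 c : R, 0 < c & forall (r : R) f e (a : nat -> R) N,
  (0 < N)%N -> sign_regular_kernel n.+1 r f e ->
  (forall x y, 0 < x -> x < y -> y < r -> f x < f y) ->
  (forall i j, (i < j < N)%N -> a i < a j) -> a N.-1 - a 0%N < r ->
  exists Z : seq R, [/\ uniq Z, c * N%:R `^ (1 + phi R n.+1) <= (size Z)%:R &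
    forall z, z \in Z -> rep (2 ^ n.+1).-1
      (fun x => exists i j, [/\ (i < N)%N, (j < N)%N & x = f (a i - a j)]) z].
Proof.
have [c c0 gr] := growth_exists n; set p := phi R n.+1.
have p0 : 0 < p by apply: lt_le_trans (phi_ge1 R n).
pose K := (8 * n.+1)%N.
pose c1 := c * 8^-1 `^ p / (4 * n.+1%:R).
have K0 : 0 < K%:R :> R by rewrite ltr0n.
have c10 : 0 < c1 by rewrite divr_gt0 ?mulr_gt0 ?powR_gt0 ?invr_gt0 ?ltr0n.
exists (Num.min (K%:R `^ (1 + p))^-1 c1); first by rewrite lt_min c10 invr_gt0 powR_gt0.
move=> r f e a N N0 ker f_incr a_incr a_r.
set X := fun x => exists _, _.
have X00 : X (f (a 0%N - a 0%N)) by exists 0%N, 0%N.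
have pp0 : 0 <= 1 + p by rewrite addr_ge0 // ltW.
have [NK|NK] := ltnP N K.
  exists [:: f (a 0%N - a 0%N)]; split=> //.
    apply: le_trans (_ : (K%:R `^ (1 + p))^-1 * K%:R `^ (1 + p) <= _).
      apply: ler_pM; rewrite ?powR_ge0 ?ge_min ?lexx ?le_min ?invr_ge0 ?powR_ge0 ?(ltW c10) //.
      by rewrite ge0_ler_powR ?nnegrE ?ler0n // ler_nat ltnW.
    by rewrite mulVf // gt_eqF // powR_gt0.
  by move=> z; rewrite inE => /eqP ->; apply: rep_pad X00 _ (rep0 X00).
(* The lower [h] points serve as subtrahends. The upper points are cut into [T] blocks of [n.+1]
   steps, and each block provides one family of [n.+1] functions. *)
pose h := N./2; pose T := ((N - 1 - h) %/ n.+1)%N.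
have hT : (h + n.+1 * T <= N.-1)%N.
  have := leq_trunc_div (N - 1 - h) n.+1; rewrite -/T mulnC /h; clear -N0; lia.
have h0 : (0 < h)%N by rewrite /h; move: NK; rewrite /K; clear; lia.
have a_le i j : (i <= j)%N -> (j < N)%N -> a i <= a j.
  by rewrite leq_eqVlt => /orP[/eqP ->//|ij] jN; rewrite ltW // a_incr ?ij.
pose i_ t := (h + n.+1 * t)%N.
(* The middle column gives a subtrahend common to all blocks, which makes the target intervals of
   successive blocks adjacent. *)
pose l_ := (h./2)%N.
(* The subtrahends are listed backwards so that the differences [a (i_ t) - a (m_ l)] increase with
   [l]. *)
pose m_ l := (h.-1 - l)%N.
pose G t j l := f (a (i_ t + j.+1)%N - a (m_ l)) - f (a (i_ t) - a (m_ l)).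
have bnd t j : (t < T)%N -> (j < n.+1)%N -> (i_ t + j.+1 <= i_ t.+1 <= N.-1)%N.
  move=> tT jn; have : (n.+1 * t.+1 <= n.+1 * T)%N by rewrite leq_mul2l tT orbT.
  by move: hT; rewrite /i_; clear -jn; lia.
have block t : (t < T)%N -> exists2 Z : seq R, uniq Z &
    c * (uphalf h)%:R `^ p <= (size Z)%:R /\
    forall z, z \in Z -> rep (2 ^ n.+1).-1 X (f (a (i_ t) - a (m_ l_)) + z) /\
      0 < z <= f (a (i_ t.+1) - a (m_ l_)) - f (a (i_ t) - a (m_ l_)).
  move=> tT.
  have reg : sign_regular n.+1 h (G t) e.
    move=> k rho kappa k0 rho_incr rho_n kappa_incr kappa_h.
    pose x l := a (i_ t) - a (m_ (kappa l)).
    pose d i := a (i_ t + (rho i).+1)%N - a (i_ t).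
    have GE i l : G t (rho i) (kappa l) = f (x l + d i) - f (x l).
      by rewrite /G /x /d; congr (f _ - _); ring.
    have kappa_le l : (l <= k)%N -> (kappa l <= kappa k)%N.
      by rewrite leq_eqVlt => /orP[/eqP ->//|lk]; rewrite ltnW // kappa_incr ?lk //=.
    have k1 : (k.-1 < k)%N by rewrite prednK.
    have kn : (k <= n.+1)%N.
      rewrite -(prednK k0); apply: leq_ltn_trans (rho_n _ k1).
      exact: increasing_ge_id rho_incr _ k1.
    rewrite (@eq_ldet _ _ _ (fun i l => f (x l.+1 + d i) - f (x l.+1) - (f (x l + d i) - f (x l)))).
      apply: ker; first by rewrite k0 kn.
      - move=> i j ij; rewrite ltrD2r a_incr // ltn_add2l ltnS rho_incr //=.
        have := bnd t (rho j) tT (rho_n j _); move: ij; clear -N0; lia.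
      - rewrite subr_gt0 a_incr //.
        have := bnd t (rho 0%N) tT (rho_n _ k0); clear -N0; lia.
      - move=> i j ij; rewrite ltrD2l ltrN2 a_incr //.
        have := kappa_incr i j ij; have := kappa_le j; move: ij kappa_h hT h0.
        rewrite /m_; clear; lia.
      - rewrite subr_gt0 a_incr //.
        have := bnd t 0%N tT isT; move: h0; rewrite /m_ /i_; clear -N0; lia.
      - apply: le_lt_trans a_r.
        rewrite [leLHS](_ : _ = a (i_ t + (rho k.-1).+1)%N - a (m_ (kappa k))); last by rewrite /x /d; ring.
        rewrite lerB // a_le //.
        + have := bnd t (rho k.-1) tT (rho_n _ k1); clear -N0; lia.
        + by rewrite prednK.
        + by move: hT N0; rewrite /m_; clear; lia.
    by move=> i l _ _; rewrite !GE.
  have posG j l : (j < n.+1)%N -> (l < h)%N -> 0 < G t j l.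
    move=> jn lh; rewrite subr_gt0; have := bnd t j tT jn => b.
    apply: f_incr.
    - rewrite subr_gt0 a_incr //; move: b h0; rewrite /m_ /i_; clear -N0; lia.
    - rewrite ltrD2r a_incr //; move: b; clear -N0; lia.
    - apply: le_lt_trans a_r; rewrite lerB // a_le //; move: b hT N0; rewrite /m_; clear; lia.
  (* Whichever half supplied the elements, [mid] says that the middle column [l_] is admissible. *)
  have [j [Z [lo [len [jn uZ Zs [_ _ mid] Zb]]]]] := growth_half (ltn0Sn n) gr h0 reg posG.
  exists Z => //; split=> // z zZ; have [rz /andP[z0 zle]] := Zb _ _ mid zZ; split.
    rewrite pred_expn2S; apply: rep_difference rz.
      move=> _ [l lh ->]; have b := bnd t j tT jn.
      exists (f (a (i_ t + j.+1)%N - a (m_ l))), (f (a (i_ t) - a (m_ l))); split=> //.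
      - exists (i_ t + j.+1)%N, (m_ l); split=> //; move: b hT N0; rewrite /m_; clear; lia.
      - exists (i_ t), (m_ l); split=> //; move: b hT N0; rewrite /m_; clear; lia.
    exists (i_ t), (m_ l_); split=> //; have := bnd t j tT jn; move: hT N0; rewrite /m_; clear; lia.
  rewrite z0 (le_trans zle) // lerD2r.
  have b := bnd t j tT jn.
  have : (i_ t + j.+1 <= i_ t.+1)%N by case/andP: b.
  rewrite leq_eqVlt => /orP[/eqP -> //|lt]; rewrite ltW // f_incr //.
  - rewrite subr_gt0 a_incr //; move: b h0; rewrite /m_ /i_; clear -N0; lia.
  - by rewrite ltrD2r a_incr // lt; move: b; clear -N0; lia.
  - apply: le_lt_trans a_r; rewrite lerB // a_le //; move: b hT N0; rewrite /m_; clear; lia.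
have /choice[Z HZ] : forall t, exists Z : seq R, (t < T)%N -> [/\ uniq Z,
    c * (uphalf h)%:R `^ p <= (size Z)%:R &
    forall z, z \in Z -> rep (2 ^ n.+1).-1 X (f (a (i_ t) - a (m_ l_)) + z) /\
      0 < z <= f (a (i_ t.+1) - a (m_ l_)) - f (a (i_ t) - a (m_ l_))].
  move=> t; have [tT|tT] := ltnP t T; last by exists [::].
  by have [Z uZ [sZ bZ]] := block t tT; exists Z.
pose u t := f (a (i_ t) - a (m_ l_)).
have [| | |Z' [uZ' sZ' bZ']] := @increasing_squeeze _ T u
    (fun t => [seq u t + z | z <- Z t]) (rep (2 ^ n.+1).-1 X).
- move=> t tT; have b := bnd t 0%N tT isT; rewrite ltW // f_incr //.
  + rewrite subr_gt0 a_incr //; move: b h0; rewrite /m_ /i_; clear -N0; lia.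
  + by rewrite ltrD2r a_incr //; move: b; clear -N0; lia.
  + apply: le_lt_trans a_r; rewrite lerB // a_le //; move: b hT N0; rewrite /m_; clear; lia.
- by move=> t /HZ[uZ _ _]; rewrite map_inj_uniq //; exact: addrI.
- move=> t x tT /mapP[z zZ ->]; have [_ _ /(_ z zZ)[rz /andP[z0 zle]]] := HZ t tT.
  by split=> //; rewrite ltrDl z0 -lerBrDl.
exists Z'; split=> //; last by move=> z /bZ'[].
rewrite sZ' natr_sum.
apply: le_trans (_ : T%:R * (c * (uphalf h)%:R `^ p) <= _); last first.
  rewrite -{1}(size_iota 0 T) -sum1_size natr_sum mulr_suml big_seq [leRHS]big_seq.
  apply: ler_sum => t; rewrite mem_iota /= add0n => /HZ[_ sZ _].
  by rewrite mul1r size_map.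
apply: le_trans (_ : c1 * N%:R `^ (1 + p) <= _).
  by rewrite ler_wpM2r ?powR_ge0 // ge_min lexx orbT.
have NR : 0 < N%:R :> R by rewrite ltr0n.
rewrite powRD ?powRr1 ?ler0n //; last by apply/implyP => _; rewrite gt_eqF.
(* The two factors are compared separately: [T] is at least $N/(4(n+1))$ and [uphalf h] is at least
   $N/8$, as [N] is not below [K]. *)
have -> : c1 * (N%:R * N%:R `^ p) =
    (N%:R / (4 * n.+1%:R)) * (c * (8^-1 * N%:R) `^ p).
  rewrite powRM ?invr_ge0 ?ler0n // /c1; field.
  by rewrite gt_eqF // -natr1 -natrD ltr0n; lia.
apply: ler_pM.
- by rewrite divr_ge0 ?mulr_ge0.
- by rewrite mulr_ge0 ?powR_ge0 ?ltW.
- rewrite ler_pdivrMr ?mulr_gt0 ?ltr0n // -natrM -natrM ler_nat.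
  have := divn_eq (N - 1 - h) n.+1; have := ltn_pmod (N - 1 - h) (ltn0Sn n).
  rewrite -/T; move: NK N0; rewrite /K /h; clear; move: (_ %% _)%N => q.
  by nia.
- rewrite ler_pM2l // ge0_ler_powR ?nnegrE ?(ltW p0) ?mulr_ge0 ?invr_ge0 ?ler0n //.
  rewrite ler_pdivrMl // -natrM ler_nat; move: N0 NK; rewrite /K /h; clear; lia.
Qed.

End OrderedGrowth.

Local Open Scope classical_set_scope.
Local Open Scope ring_scope.

(** * Real analytic functions *)

Section PowerSeries.
Variable R : realType.
Implicit Types (c d : R^nat) (f g : R -> R) (r x y : R).

Definition expands c r x0 f :=
  0 < r /\ forall x, `|x - x0| < r -> pseries c (x - x0) @ \oo --> f x.

Lemma expandsW c r r' x0 f : 0 < r' <= r -> expands c r x0 f -> expands c r' x0 f.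
Proof.
move=> /andP[r'0 r'r] [_ cf]; split=> // x xr; apply: cf; exact: lt_le_trans r'r.
Qed.

(** A radius $M = (1+s)K$ strictly between [K] and [L] leaves a geometric factor $(1+s)^i$ that
    dominates the linear factor produced by differentiation. *)
Lemma is_cvg_pseries_diffs c K L : 0 < K < L -> cvgn (pseries c L) ->
  cvgn (pseries (pseries_diffs c) K).
Proof.
move=> /andP[K0 KL] cL.
pose s := Num.min 1 ((L - K) / (2 * K)).
have s0 : 0 < s by rewrite lt_min ltr01 divr_gt0 ?subr_gt0 ?mulr_gt0.
have s1 : s <= 1 by rewrite ge_min lexx.
pose M := (1 + s) * K.
have M0 : 0 < M by rewrite mulr_gt0 // addr_gt0.
have ML : M < L.
  rewrite /M mulrDl mul1r -ltrBrDl.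
  apply: (@le_lt_trans _ _ ((L - K) / 2)).
    rewrite -ler_pdivlMr // -mulrA -invfM; apply: (le_trans (_ : s <= (L - K) / (2 * K))) => //.
    by rewrite ge_min lexx orbT.
  by rewrite ltr_pdivrMr // ltr_pMr ?subr_gt0 // ltr1n.
have cM : cvgn (pseries (fun i => `|c i|) M).
  apply: is_cvg_pseries_inside_norm cL _; rewrite !gtr0_norm //.
  exact: lt_trans ML.
apply: normed_cvg.
have bernoulli i : i.+1%:R * s <= (1 + s) ^+ i.
  elim: i => [|i IH]; first by rewrite mul1r expr0.
  rewrite -natr1 mulrDl mul1r exprS [leRHS]mulrDl mul1r lerD //.
  by rewrite ler_peMr ?(ltW s0) // exprn_ege1 // lerDl ltW.
have cM' : cvgn (series (fun i => `|c i.+1| * M ^+ i.+1)).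
  have -> : series (fun i => `|c i.+1| * M ^+ i.+1) =
     (fun n => pseries (fun i => `|c i|) M n.+1 - `|c 0%N|).
    apply/funext => n; rewrite /pseries /series /= big_nat_recl // expr0 mulr1.
    by rewrite -[RHS]/(_ + _ - _) addrC addKr.
  apply: is_cvgB; last exact: is_cvg_cst.
  by apply/cvg_ex; exists (limn (pseries (fun i => `|c i|) M)); rewrite (cvg_shiftS (pseries _ _)).
have cM'' := @is_cvg_seriesZ _ _ (s * M)^-1 cM'.
apply: series_le_cvg cM'' => [n|n|n] /=.
- exact: normr_ge0.
- apply: mulr_ge0; first by rewrite invr_ge0 mulr_ge0 ?ltW.
  by apply: mulr_ge0; rewrite ?exprn_ge0 ?(ltW M0).
rewrite /pseries_diffs !normrM normrX (gtr0_norm K0) normr_nat.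
rewrite -[leRHS]/((s * M)^-1 * (`|c n.+1| * M ^+ n.+1)).
have -> : (s * M)^-1 * (`|c n.+1| * M ^+ n.+1) =
    `|c n.+1| * (s^-1 * (1 + s) ^+ n * K ^+ n).
  rewrite exprS /M exprMn; field.
  by rewrite !gt_eqF // addr_gt0.
have -> : n.+1%:R * `|c n.+1| * K ^+ n = `|c n.+1| * (n.+1%:R * K ^+ n) by ring.
apply: ler_wpM2l => //; apply: ler_wpM2r; first by rewrite exprn_ge0 ?(ltW K0).
by rewrite ler_pdivlMl // mulrC.
Qed.

Lemma is_derive_center f x0 x l :
  is_derive (x - x0) 1 f l -> is_derive x 1 (fun y => f (y - x0)) l.
Proof.
have E : (fun h => h^-1 *: (((fun y => f (y - x0)) \o shift x) (h *: 1) - f (x - x0))) =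
         (fun h => h^-1 *: ((f \o shift (x - x0)) (h *: 1) - f (x - x0))).
  by apply/funext => h /=; rewrite addrA.
move=> [df <-]; apply: DeriveDef; first by rewrite /derivable E.
by rewrite /derive E.
Qed.

Lemma expands_is_derive c r x0 f x : expands c r x0 f -> `|x - x0| < r ->
  is_derive x 1 f (limn (pseries (pseries_diffs c) (x - x0))) /\
  pseries (pseries_diffs c) (x - x0) @ \oo --> limn (pseries (pseries_diffs c) (x - x0)).
Proof.
move=> [r0 cf] xr.
(* A ladder of radii between [|x - x0|] and [r]: each termwise differentiation costs one rung, and
   two are carried out before the criterion is applied at [K 1]. *)
pose K i : R := `|x - x0| + (r - `|x - x0|) * (i.+1%:R / 5).
have gap0 : 0 < r - `|x - x0| by rewrite subr_gt0.
have K_lt i : `|x - x0| < K i by rewrite ltrDl mulr_gt0 ?divr_gt0.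
have K0 i : 0 < K i by apply: le_lt_trans (K_lt i).
have KS i : 0 < K i < K i.+1.
  by rewrite K0 /= ltrD2l ltr_pM2l // ltr_pM2r ?invr_gt0 // ltr_nat.
have Kr : K 3%N < r.
  by rewrite /K -ltrBrDl gtr_pMr // ltr_pdivrMr // mul1r ltr_nat.
have cK3 : cvgn (pseries c (K 3%N)).
  have := cf (x0 + K 3%N); rewrite [x0 + _]addrC addrK gtr0_norm ?K0 // => /(_ Kr) h.
  by apply/cvg_ex; eexists; exact: h.
have cK2 := is_cvg_pseries_diffs (KS 2%N) cK3.
have cK1 := is_cvg_pseries_diffs (KS 1%N) cK2.
have inside c' i j : (i < j)%N -> cvgn (pseries c' (K j)) -> cvgn (pseries c' (K i)).
  move=> ij h; apply: is_cvg_pseries_inside h _; rewrite !gtr0_norm ?K0 //.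
  by rewrite ltrD2l ltr_pM2l // ltr_pM2r ?invr_gt0 // ltr_nat.
have xK1 : `|x - x0| < `|K 1%N| by rewrite [ltRHS]gtr0_norm ?K0 ?K_lt.
split; last first.
  by apply: is_cvg_pseries_inside xK1; exact: inside cK2.
have der := pseries_snd_diffs (inside _ 1%N 3%N isT cK3) (inside _ 1%N 2%N isT cK2) cK1 xK1.
apply: (@near_eq_is_derive _ _ _ (fun y => limn (pseries c (y - x0)))).
  have : \forall y \near x, `|y - x0| < r.
    near=> y; have : `|x - y| < r - `|x - x0| by near: y; apply: cvgr_dist_lt => //.
    rewrite ltrBrDr distrC; apply: le_lt_trans.
    by rewrite (_ : y - x0 = (y - x) + (x - x0)); [exact: ler_normD|ring].
  apply: filterS => y yr; apply/cvg_lim => //; exact: cf.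
exact: is_derive_center der.
Unshelve. all: by end_near.
Qed.

Lemma expands_derivable c r x0 f x : expands c r x0 f -> `|x - x0| < r ->
  derivable f x 1.
Proof. by move=> cf xr; have [[]] := expands_is_derive cf xr. Qed.

Lemma expands_derive1 c r x0 f : expands c r x0 f ->
  expands (pseries_diffs c) r x0 (derive1 f).
Proof.
move=> /[dup] -[r0 _] cf; split=> // x xr; have [[_ df] cv] := expands_is_derive cf xr.
by rewrite derive1E df.
Qed.

Lemma expands_derive1n c r x0 f m : expands c r x0 f ->
  expands (iter m (@pseries_diffs R) c) r x0 (derive1n m f).
Proof. by move=> cf; elim: m => //= m; exact: expands_derive1. Qed.

Lemma iter_pseries_diffs c m i : exists2 k : nat, (0 < k)%N &
  iter m (@pseries_diffs R) c i = k%:R * c (i + m)%N.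
Proof.
elim: m i => [|m IH] i; first by exists 1%N; rewrite //= mul1r addn0.
have [k k0 e] := IH i.+1; exists (i.+1 * k)%N; first by rewrite muln_gt0.
by rewrite /= /pseries_diffs e natrM mulrA addnS addSn.
Qed.

Lemma expands_center c r x0 f : expands c r x0 f -> f x0 = c 0%N.
Proof.
move=> [r0 cf]; have := cf x0; rewrite subrr normr0 => /(_ r0) cvf.
apply: (cvg_unique _ cvf) => //; apply/cvgrPdist_lt => e e0.
near=> n; rewrite /pseries /series /=.
have n0 : (0 < n)%N by near: n; exact: nbhs_infty_gt.
rewrite -(prednK n0) big_nat_recl // expr0 mulr1 big1 ?addr0 ?subrr ?normr0 //.
by move=> i _; rewrite expr0n /= mulr0.
Unshelve. all: by end_near. Qed.

(** The constant coefficient of the [i]-th derived series is a positive multiple of [c i] and equals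
    the [i]-th derivative at [x0]. *)
Lemma expands_flat c r x0 f : expands c r x0 f ->
  (forall m, derive1n m f x0 = 0) -> forall i, c i = 0.
Proof.
move=> cf flat i; have := expands_center (expands_derive1n i cf).
have [k k0 ->] := iter_pseries_diffs c i 0%N; rewrite flat add0n => /esym/eqP.
by rewrite mulf_eq0 pnatr_eq0 gtn_eqF //= => /eqP.
Qed.

Lemma expands_eq0 c r x0 f : expands c r x0 f -> (forall i, c i = 0) ->
  forall x, `|x - x0| < r -> f x = 0.
Proof.
move=> [_ cf] c0 x /cf cv; apply: (cvg_unique _ cv) => //.
rewrite (_ : pseries c _ = cst 0); first exact: cvg_cst.
by apply/funext => n; rewrite /pseries /series /= big1 // => i _; rewrite c0 mul0r.
Qed.

Lemma expands_isolated c r x0 f : expands c r x0 f ->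
  (forall x, `|x - x0| < r -> f x = 0) \/ \forall x \near x0^', f x != 0.
Proof.
move=> cf; have [/(expands_eq0 cf)|] := pselect (forall i, c i = 0); first by left.
move=> c_neq0; right.
have [p0 cp0] : exists p, c p != 0.
  apply: contrapT => h; apply: c_neq0 => i; apply/eqP/negPn/negP => ci.
  by apply: h; exists i.
have [p cp pmin] := ex_minnP (ex_intro (fun p => c p != 0) p0 cp0).
(* Here [p] is the order of vanishing at [x0]. Dividing by the corresponding power leaves a
   convergent power series with nonzero constant coefficient [c p], so [g] is continuous and nonzero
   at [x0]. *)
pose g x := if x == x0 then c p else f x / (x - x0) ^+ p.
have cg : expands (fun i => c (p + i)%N) r x0 g.
  have [r0 cfx] := cf; split=> // x xr; rewrite /g; case: eqP => [->|/eqP xx0].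
    rewrite subrr; apply/cvgrPdist_lt => e e0; near=> n.
    have n0 : (0 < n)%N by near: n; exact: nbhs_infty_gt.
    rewrite /pseries /series /= -(prednK n0).
    rewrite big_nat_recl // addn0 expr0 mulr1 big1 ?addr0 ?subrr ?normr0 //.
    by move=> i _; rewrite expr0n /= mulr0.
  have xp : (x - x0) ^+ p != 0 by rewrite expf_neq0 // subr_eq0.
  rewrite (_ : pseries _ _ = (fun n => pseries c (x - x0) (n + p)%N / (x - x0) ^+ p)).
    by apply: cvgMr_tmp; rewrite (cvg_shiftn p (pseries c (x - x0))); exact: cfx.
  apply/funext => n; rewrite /pseries /series /= addnC.
  rewrite [in RHS](big_cat_nat (n := p)) ?leq_addr //= [X in (X + _) / _]big1_seq ?add0r; last first.
    move=> i; rewrite mem_index_iota => /andP[_ /andP[_ ip]].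
    have [->|ci] := eqVneq (c i) 0; first by rewrite mul0r.
    by have := pmin _ ci; rewrite leqNgt ip.
  rewrite (big_addn 0 _ p) addKn mulr_suml; apply: eq_bigr => i _.
  by rewrite addnC exprD mulrA mulfK // addnC.
have : {for x0, continuous g}.
  have [r0 _] := cf; apply/differentiable_continuous/derivable1_diffP.
  by apply: expands_derivable cg _; rewrite subrr normr0.
move=> gc; have : \forall x \near x0, g x != 0.
  by apply: (cvgr_neq0 _ gc); rewrite /g eqxx.
rewrite near_withinE; apply: filterS => x + xx0.
by rewrite /g (negPf xx0); apply: contra => /eqP ->; rewrite mul0r.
Unshelve. all: by end_near. Qed.

End PowerSeries.

(** * Cauchy products of absolutely convergent series *)

Section CauchyProduct.
Variable R : realType.
Implicit Types (u v : R^nat) (f g : R -> R).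

Definition convolution u v n : R := \sum_(0 <= i < n.+1) u i * v (n - i)%N.

Lemma series_convolution u v n : series (convolution u v) n =
  \sum_(0 <= i < n) \sum_(0 <= j < n - i) u i * v j.
Proof.
elim: n => [|n IH]; first by rewrite /series /= !big_nil.
rewrite seriesSr IH [RHS]big_nat_recr //= subSnn big_nat1 /convolution big_nat_recr //= subnn.
rewrite addrA; congr (_ + _); rewrite -big_split /=.
rewrite big_seq_cond [RHS]big_seq_cond; apply: eq_bigr => i.
rewrite mem_index_iota andbT => /andP[_ ni].
by rewrite subSn 1?ltnW // big_nat_recr.
Qed.

(** The left side is a sum over the index square of side [n] without the triangle $i+j<n$. That
    triangle contains the square of side [n./2], so in absolute values the difference of the two
    squares is an upper bound. *)
Lemma cauchy_product_bound u v n :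
  `|series u n * series v n - series (convolution u v) n| <=
  series (fun i => `|u i|) n * series (fun i => `|v i|) n -
  series (fun i => `|u i|) n./2 * series (fun i => `|v i|) n./2.
Proof.
rewrite series_convolution /series /=.
pose D i j : bool := (i + j < n)%N.
have tri (x : nat -> nat -> R) : \sum_(0 <= i < n) \sum_(0 <= j < n - i) x i j =
    \sum_(0 <= i < n) \sum_(0 <= j < n) (if D i j then x i j else 0).
  rewrite big_seq [RHS]big_seq; apply: eq_bigr => i; rewrite mem_index_iota => /andP[_ ni].
  rewrite [RHS](big_cat_nat (n := (n - i)%N)) ?leq_subr //= [X in _ + X]big1_seq ?addr0; last first.
    move=> j /andP[_]; rewrite mem_index_iota => /andP[nij _].
    by rewrite /D ifF //; lia.
  rewrite big_seq [RHS]big_seq; apply: eq_bigr => j; rewrite mem_index_iota => /andP[_ nj].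
  by rewrite /D ifT //; lia.
have sq (a b : nat -> R) m : (\sum_(0 <= i < m) a i) * (\sum_(0 <= j < m) b j) =
    \sum_(0 <= i < m) \sum_(0 <= j < m) a i * b j.
  by rewrite mulr_suml; apply: eq_bigr => i _; rewrite mulr_sumr.
have small : (\sum_(0 <= i < n./2) `|u i|) * (\sum_(0 <= j < n./2) `|v j|) <=
    \sum_(0 <= i < n) \sum_(0 <= j < n) (if D i j then `|u i| * `|v j| else 0).
  have pos i j : 0 <= (if D i j then `|u i| * `|v j| else 0).
    by case: ifP => // _; rewrite mulr_ge0.
  have le m (a b : nat -> R) : (m <= n)%N -> (forall i, 0 <= b i) ->
      (forall i, (i < m)%N -> a i <= b i) -> \sum_(0 <= i < m) a i <= \sum_(0 <= i < n) b i.
    move=> mn b0 ab; rewrite [leRHS](big_cat_nat (n := m)) //= ler_wpDr ?sumr_ge0 //.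
    by rewrite big_seq [leRHS]big_seq; apply: ler_sum => i; rewrite mem_index_iota => /andP[_ /ab].
  rewrite sq; apply: (le n./2 (fun i => \sum_(0 <= j < n./2) `|u i| * `|v j|)
    (fun i => \sum_(0 <= j < n) (if D i j then `|u i| * `|v j| else 0))).
  - lia.
  - by move=> i; apply: sumr_ge0.
  move=> i im; apply: (le n./2 (fun j => `|u i| * `|v j|)
    (fun j => if D i j then `|u i| * `|v j| else 0)) => [|//|j jm]; first by lia.
  by rewrite /D ifT //; lia.
apply: le_trans (_ : _ <= (\sum_(0 <= i < n) `|u i|) * (\sum_(0 <= j < n) `|v j|) -
    \sum_(0 <= i < n) \sum_(0 <= j < n) (if D i j then `|u i| * `|v j| else 0)) _; last first.
  by rewrite lerD2l lerN2.
rewrite tri !sq -!sumrB; apply: le_trans (ler_norm_sum _ _ _) _; apply: ler_sum => i _.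
rewrite -!sumrB; apply: le_trans (ler_norm_sum _ _ _) _; apply: ler_sum => j _.
by case: ifP => _; rewrite ?subrr ?normr0 // !subr0 normrM.
Qed.

Lemma cvg_cauchy_product u v (a b : R) :
  cvgn (series (fun i => `|u i|)) -> cvgn (series (fun i => `|v i|)) ->
  series u @ \oo --> a -> series v @ \oo --> b ->
  series (convolution u v) @ \oo --> a * b.
Proof.
move=> cu cv ua vb.
set Su := series (fun i => `|u i|) in cu *; set Sv := series (fun i => `|v i|) in cv *.
have half : (fun n => n./2) @ \oo --> \oo.
  move=> A [N _ NA]; exists N.*2 => // n /= nN; apply: NA => /=; lia.
have bound0 : (fun n => Su n * Sv n - Su n./2 * Sv n./2) @ \oo --> (0 : R).
  rewrite -(subrr (limn Su * limn Sv)); apply: cvgB; apply: cvgM; [exact: cu|exact: cv| |].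
  - exact: (cvg_comp _ _ half cu).
  - exact: (cvg_comp _ _ half cv).
have diff0 : (fun n => series u n * series v n - series (convolution u v) n) @ \oo --> (0 : R).
  apply: norm_cvg0; apply: (squeeze_cvgr _ (cvg_cst 0) bound0).
  by apply: nearW => n /=; rewrite normr_ge0 cauchy_product_bound.
have -> : series (convolution u v) = (fun n => series u n * series v n -
    (series u n * series v n - series (convolution u v) n)).
  by apply/funext => n; rewrite subKr.
by rewrite -[a * b]subr0; exact: cvgB (cvgM ua vb) diff0.
Qed.

End CauchyProduct.

(** * Closure properties of analytic functions and the identity theorem *)

Section AnalyticAt.
Variable R : realType.
Implicit Types (c d : R^nat) (f g : R -> R) (x y : R).

Definition analytic_at f x0 := exists c r, expands c r x0 f.

Lemma analytic_on_at (J : set R) f x0 : analytic_on J f -> J x0 -> analytic_at f x0.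
Proof.
move=> an /an[c /nbhs_ballP[r /= r0 cf]]; exists c, r; split=> // x xr.
by apply: cf; rewrite /ball /= distrC.
Qed.

Lemma analytic_at_cst (k : R) x0 : analytic_at (fun=> k) x0.
Proof.
exists (fun i => if i is 0 then k else 0), 1; split=> // x _.
apply/cvgrPdist_lt => e e0; near=> n.
have n0 : (0 < n)%N by near: n; exact: nbhs_infty_gt.
rewrite /pseries /series /= -(prednK n0) big_nat_recl // expr0 mulr1 big1.
  by rewrite addr0 subrr normr0.
by move=> i _; rewrite mul0r.
Unshelve. all: by end_near. Qed.

Lemma analytic_at2 f g x0 : analytic_at f x0 -> analytic_at g x0 ->
  exists c d r, expands c r x0 f /\ expands d r x0 g.
Proof.
move=> [c [r cf]] [d [s dg]]; exists c, d, (Num.min r s).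
have m0 : 0 < Num.min r s by rewrite lt_min; case: cf dg => -> _ [-> _].
by split; [apply: expandsW cf|apply: expandsW dg]; rewrite m0 ge_min lexx ?orbT.
Qed.

Lemma analytic_atD f g x0 : analytic_at f x0 -> analytic_at g x0 ->
  analytic_at (fun x => f x + g x) x0.
Proof.
move=> /analytic_at2 /[apply] -[c [d [r [[r0 cf] [_ dg]]]]].
exists (fun i => c i + d i), r; split=> // x xr.
have -> : pseries (fun i => c i + d i) (x - x0) = pseries c (x - x0) + pseries d (x - x0).
  apply/funext => n; rewrite /pseries /series /= fctE -big_split /=.
  by apply: eq_bigr => i _; rewrite mulrDl.
exact: cvgD (cf x xr) (dg x xr).
Qed.

Lemma analytic_atM f g x0 : analytic_at f x0 -> analytic_at g x0 ->
  analytic_at (fun x => f x * g x) x0.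
Proof.
move=> /analytic_at2 /[apply] -[c [d [r [[r0 cf] [_ dg]]]]].
exists (convolution c d), r; split=> // x xr.
(* Convergence at a radius [y] strictly between [|x - x0|] and [r] gives absolute convergence at
   [x]. *)
have normal a h : expands a r x0 h -> cvgn (series (fun i => `|a i * (x - x0) ^+ i|)).
  move=> [_ ah]; pose y := (`|x - x0| + r) / 2.
  have xy : `|x - x0| < y by rewrite ltr_pdivlMr // mulr2n mulrDr mulr1 ltrD2l.
  have y0 : 0 < y by apply: le_lt_trans xy.
  have yr : y < r by rewrite ltr_pdivrMr // mulr2n mulrDr mulr1 ltrD2r.
  have ay : cvgn (pseries a y).
    have := ah (x0 + y); rewrite [x0 + _]addrC addrK gtr0_norm // => /(_ yr) l.
    by apply/cvg_ex; eexists; exact: l.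
  have := @is_cvg_pseries_inside_norm _ a y `|x - x0| ay.
  rewrite normr_id (gtr0_norm y0) => /(_ xy).
  rewrite (_ : pseries _ _ = series (fun i => `|a i * (x - x0) ^+ i|)) //.
  by apply/funext => n; apply: eq_bigr => i _; rewrite normrM normrX.
have := cvg_cauchy_product (normal c f (conj r0 cf)) (normal d g (conj r0 dg)) (cf x xr) (dg x xr).
rewrite (_ : series _ = pseries (convolution c d) (x - x0)); first by apply.
apply/funext => n; apply: eq_bigr => k _; rewrite /= /convolution mulr_suml.
rewrite big_seq [RHS]big_seq; apply: eq_bigr => i; rewrite mem_index_iota ltnS => /andP[_ ik].
by rewrite (_ : (x - x0) ^+ k = (x - x0) ^+ i * (x - x0) ^+ (k - i)); [ring|rewrite -exprD subnKC].
Qed.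

Lemma analytic_at_sum (I : Type) (s : seq I) (P : pred I) (F : I -> R -> R) x0 :
  (forall i, P i -> analytic_at (F i) x0) ->
  analytic_at (fun x => \sum_(i <- s | P i) F i x) x0.
Proof.
move=> Fan; elim: s => [|i s IH].
  rewrite (_ : (fun x => _) = (fun=> 0)); first exact: analytic_at_cst.
  by apply/funext => x; rewrite big_nil.
rewrite (_ : (fun x => _) = (fun x => if P i then F i x + \sum_(j <- s | P j) F j x
    else \sum_(j <- s | P j) F j x)); last by apply/funext => x; rewrite big_cons.
case Pi: (P i) => //.
exact: analytic_atD (Fan i Pi) IH.
Qed.

Lemma analytic_at_prod (I : Type) (s : seq I) (P : pred I) (F : I -> R -> R) x0 :
  (forall i, P i -> analytic_at (F i) x0) ->
  analytic_at (fun x => \prod_(i <- s | P i) F i x) x0.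
Proof.
move=> Fan; elim: s => [|i s IH].
  rewrite (_ : (fun x => _) = (fun=> 1)); first exact: analytic_at_cst.
  by apply/funext => x; rewrite big_nil.
rewrite (_ : (fun x => _) = (fun x => if P i then F i x * \prod_(j <- s | P j) F j x
    else \prod_(j <- s | P j) F j x)); last by apply/funext => x; rewrite big_cons.
case Pi: (P i) => //.
exact: analytic_atM (Fan i Pi) IH.
Qed.

Lemma analytic_at_ldet k (M : nat -> nat -> R -> R) x0 :
  (forall i j, (i < k)%N -> (j < k)%N -> analytic_at (M i j) x0) ->
  analytic_at (fun x => ldet k (fun i j => M i j x)) x0.
Proof.
move=> Man; apply: analytic_at_sum => s _.
apply: analytic_atM; first exact: analytic_at_cst.
rewrite (_ : (fun x => _) = (fun x => \prod_(i < k) M i (s i) x)); last first.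
  by apply/funext => x; apply: eq_bigr => i _; rewrite mxE.
by apply: analytic_at_prod => i _; apply: Man.
Qed.

Lemma analytic_at_shift f h x0 : analytic_at f (x0 + h) ->
  analytic_at (fun x => f (x + h)) x0.
Proof.
move=> [c [r [r0 cf]]]; exists c, r; split=> // x xr.
by have := cf (x + h); rewrite opprD addrACA subrr addr0; apply.
Qed.

Lemma analytic_at_derivable f x0 : analytic_at f x0 -> derivable f x0 1.
Proof.
by move=> [c [r cf]]; apply: (expands_derivable cf); rewrite subrr normr0; case: cf.
Qed.

Lemma analytic_at_derive1n f x0 m : analytic_at f x0 -> analytic_at (derive1n m f) x0.
Proof.
by move=> [c [r cf]]; exists (iter m (@pseries_diffs R) c), r; exact: expands_derive1n.
Qed.

Lemma analytic_at_isolated f x0 : analytic_at f x0 ->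
  (\forall x \near x0, f x = 0) \/ \forall x \near x0^', f x != 0.
Proof.
move=> [c [r cf]]; have [f0|] := expands_isolated cf; last by right.
left; have [r0 _] := cf; apply/nbhs_ballP; exists r => //= x xr.
by apply: f0; rewrite distrC.
Qed.

Lemma analytic_at_flat f x0 : analytic_at f x0 -> (forall m, derive1n m f x0 = 0) ->
  \forall x \near x0, f x = 0.
Proof.
move=> [c [r cf]] flat; have [r0 _] := cf; apply/nbhs_ballP; exists r => //= x xr.
by apply: (expands_eq0 cf (expands_flat cf flat)); rewrite distrC.
Qed.

(** The points near which [f] vanishes form a subset of [D] that is open and closed in [D]; it is
    closed because at a limit of such points the zero cannot be isolated. *)
Lemma analytic_identity (D : set R) f x0 : connected D -> D x0 ->
  (forall x, D x -> analytic_at f x) -> (\forall x \near x0, f x = 0) ->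
  forall x, D x -> f x = 0.
Proof.
move=> Dc Dx0 fan f0.
pose Z := [set x : R | \forall y \near x, f y = 0].
pose B := D `&` Z.
have BD : B = D.
  apply: Dc; first by exists x0.
    exists Z => //; rewrite openE => x; exact: nbhs_interior.
  exists (closure Z); first exact: closed_closure.
  rewrite eqEsubset; split=> x [Dx Zx]; split=> //; first exact: subset_closure.
  have [//|f_neq0] := analytic_at_isolated (fan x Dx).
  have [z [Zz zx]] := Zx _ f_neq0.
  have [<-//|zx0] := eqVneq z x.
  by have /eqP := zx zx0; have := nbhs_singleton Zz.
by move=> x; rewrite -BD => -[_ /nbhs_singleton].
Qed.

End AnalyticAt.

(** * Wronskians and Chebyshev systems *)

Section MoreMinors.
Variable R : realFieldType.
Implicit Types M N L : nat -> nat -> R.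

Lemma ldet_unit_row k M : M 0 0 = 1 -> (forall j, (j < k)%N -> M 0 j.+1 = 0) ->
  ldet k.+1 M = ldet k (fun i j => M i.+1 j.+1).
Proof.
move=> M1 M0; rewrite /ldet (expand_det_row _ ord0) big_ord_recl big1 ?addr0 => [|j _]; last first.
  by rewrite mxE /= M0 // mul0r.
rewrite mxE /= M1 mul1r /cofactor /= addn0 expr0 mul1r; congr (\det _).
by apply/matrixP => i j; rewrite !mxE /= /bump /= !add1n.
Qed.

(** Both sides evaluate one bordered determinant with a row of ones: expanding along a unit vector
    gives the left side, subtracting neighbouring columns the right side. *)
Lemma ldet_increments_from0 k (w : nat -> nat -> R) :
  ldet k (fun l i => w l i.+1 - w l 0) = ldet k (fun l i => w l i.+1 - w l i).
Proof.
pose M l i := if l is l'.+1 then w l' i - w l' 0%N else 1.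
transitivity (ldet k.+1 M).
  rewrite -[LHS](ldet_tr k (fun l i => w l i.+1 - w l 0%N)) -[RHS](ldet_tr k.+1 M).
  by rewrite ldet_unit_row // => j _; rewrite /M subrr.
rewrite ldet_ones //; apply: eq_ldet => i j _ _ /=.
by rewrite opprB addrA subrK.
Qed.

Lemma ldet_mul_triangular k M N L :
  (forall p j, (j < p < k)%N -> L p j = 0) ->
  (forall i j, (i < k)%N -> (j < k)%N -> M i j = \sum_(0 <= p < k) N i p * L p j) ->
  ldet k M = ldet k N * \prod_(j < k) L j j.
Proof.
move=> L0 MNL; rewrite /ldet.
have -> : \matrix_(i < k, j < k) M i j = (\matrix_(i < k, j < k) N i j) *m
    (\matrix_(i < k, j < k) L i j).
  apply/matrixP => i j; rewrite !mxE MNL // big_mkord.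
  by apply: eq_bigr => p _; rewrite !mxE.
rewrite det_mulmx; congr (_ * _); rewrite -det_tr det_trig.
  by apply: eq_bigr => i _; rewrite !mxE.
by apply/is_trig_mxP => i j ij; rewrite !mxE L0 // ij /=.
Qed.

End MoreMinors.

Section Smooth.
Variable R : realType.
Variable O : set R.
Hypothesis O_open : open O.
Implicit Types (f g h w : R -> R) (x : R).

(** This is [n]-fold differentiability at the points of [O]; quantified over [n] it gives
    smoothness. *)
Fixpoint Cn n f := if n is n'.+1 then
  (forall x, O x -> derivable f x 1) /\ Cn n' (derive1 f) else True.

Definition smooth f := forall n, Cn n f.

Lemma near_open (P : R -> Prop) x : (forall y, O y -> P y) -> O x ->
  \forall y \near x, P y.
Proof.
move=> OP Ox; have : nbhs x O by exact: open_nbhs_nbhs.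
exact: filterS.
Qed.

Lemma derive1_ext f g x : (forall y, O y -> f y = g y) -> O x ->
  derive1 f x = derive1 g x.
Proof. by move=> fg Ox; rewrite !derive1E; apply/near_eq_derive/near_open. Qed.

Lemma derivable_ext f g x : (forall y, O y -> f y = g y) -> O x ->
  derivable f x 1 -> derivable g x 1.
Proof. by move=> fg Ox; apply/near_eq_derivable/near_open. Qed.

Lemma Cn_ext n f g : (forall y, O y -> f y = g y) -> Cn n f -> Cn n g.
Proof.
elim: n f g => //= n IH f g fg [df cf]; split.
  by move=> x Ox; apply: derivable_ext (df x Ox).
by apply: IH cf => y Oy; exact: derive1_ext.
Qed.

Lemma CnS n f : Cn n.+1 f -> Cn n f.
Proof. by elim: n f => //= n IH f [df cf]; split=> //; exact: IH. Qed.

Lemma Cn_add n f g : Cn n f -> Cn n g -> Cn n (fun x => f x + g x).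
Proof.
elim: n f g => //= n IH f g [df cf] [dg cg]; split.
  by move=> x Ox; apply: derivableD; [exact: df|exact: dg].
apply: Cn_ext (IH _ _ cf cg) => y Oy; rewrite !derive1E.
by rewrite -[RHS]/('D_1 (f + g) y) deriveD //; [exact: df|exact: dg].
Qed.

Lemma derive1_mul f g x : derivable f x 1 -> derivable g x 1 ->
  derive1 (fun y => f y * g y) x = derive1 f x * g x + f x * derive1 g x.
Proof.
move=> df dg; transitivity ('D_1 (f * g) x); first by rewrite derive1E.
rewrite (deriveM df dg) -!derive1E.
by rewrite -[LHS]/(f x * derive1 g x + g x * derive1 f x) addrC [g x * _]mulrC.
Qed.

Lemma Cn_mul n f g : Cn n f -> Cn n g -> Cn n (fun x => f x * g x).
Proof.
elim: n f g => // n IH f g /[dup] cf [df cf'] /[dup] cg [dg cg']; split.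
  by move=> x Ox; apply: derivableM; [exact: df|exact: dg].
apply: (@Cn_ext _ (fun x => derive1 f x * g x + f x * derive1 g x)).
  by move=> y Oy; rewrite derive1_mul //; [exact: df|exact: dg].
by apply: Cn_add; apply: IH => //; exact: CnS.
Qed.

Lemma Cn_cst n (k : R) : Cn n (fun=> k).
Proof.
elim: n k => //= n IH k; split=> [x _|]; first exact: derivable_cst.
by apply: Cn_ext (IH 0) => y _; rewrite derive1_cst.
Qed.

Lemma Cn_inv n f : (forall x, O x -> f x != 0) -> Cn n f -> Cn n (fun x => (f x)^-1).
Proof.
move=> f0; elim: n => // n IH /[dup] cf [df cf']; split.
  by move=> x Ox; apply: derivableV; [exact: f0|exact: df].
apply: (@Cn_ext _ (fun x => -1 * derive1 f x * ((f x)^-1 * (f x)^-1))).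
  move=> y Oy; rewrite !derive1E deriveV ?f0 //; last exact: df.
  by rewrite -exprVn expr2 mulN1r mulrC scaleNr mulrN.
have ci : Cn n (fun x => (f x)^-1) by apply/IH/CnS.
by apply: Cn_mul; apply: Cn_mul => //; exact: Cn_cst.
Qed.

Lemma smooth_derivable f x : smooth f -> O x -> derivable f x 1.
Proof. by move=> /(_ 1%N)[df _]; exact: df. Qed.

Lemma smooth_derive1 f : smooth f -> smooth (derive1 f).
Proof. by move=> sf n; have [] := sf n.+1. Qed.

Lemma smooth_derive1n f n : smooth f -> smooth (derive1n n f).
Proof. by elim: n f => // n IH f sf; apply/smooth_derive1/IH. Qed.

End Smooth.

(** * Wronskians and their reduction by one function *)

Section Wronskian.
Variable R : realType.
Variable O : set R.
Hypothesis O_open : open O.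
Implicit Types (f g h w : R -> R) (u v : nat -> R -> R) (x : R).

Definition wronskian k u x := ldet k (fun i j => derive1n j (u i) x).

(* [leibniz_coef h j p] is the coefficient of the [p]-th derivative of [w] in
   the [j]-th derivative of [h * w]. *)
Fixpoint leibniz_coef h j p : R -> R := if j is j'.+1 then
  fun x => derive1 (leibniz_coef h j' p) x +
    (if p is p'.+1 then leibniz_coef h j' p' x else 0)
  else if p is 0 then h else fun=> 0.

Lemma leibniz_coef_gt h j p : (j < p)%N -> leibniz_coef h j p = fun=> 0.
Proof.
elim: j p => [|j IH] [|p] //= jp; apply/funext => x.
by rewrite !IH ?derive1_cst ?addr0 // ltnW.
Qed.

Lemma leibniz_coef_diag h j : leibniz_coef h j j = h.
Proof.
elim: j => //= j IH; apply/funext => x.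
by rewrite leibniz_coef_gt // derive1_cst add0r IH.
Qed.

Lemma smooth_leibniz_coef h j p : smooth O h -> smooth O (leibniz_coef h j p).
Proof.
move=> sh; elim: j p => [|j IH] [|p] //=; try by move=> n; exact: Cn_cst.
- move=> n; apply: Cn_add => //; last exact: Cn_cst.
  exact: (smooth_derive1 (IH _)).
- move=> n; apply: Cn_add => //; first exact: (smooth_derive1 (IH _)).
  exact: IH.
Qed.

Lemma leibniz h w j x : smooth O h -> smooth O w -> O x ->
  derive1n j (fun y => h y * w y) x =
  \sum_(0 <= p < j.+1) leibniz_coef h j p x * derive1n p w x.
Proof.
move=> sh sw; elim: j x => [|j IH] x Ox; first by rewrite big_nat1.
rewrite derive1nS (derive1_ext O_open IH Ox).
have der p : derivable (fun y => leibniz_coef h j p y * derive1n p w y) x 1.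
  apply: derivableM; apply: smooth_derivable Ox => //.
    exact: smooth_leibniz_coef.
  exact: smooth_derive1n.
transitivity (\sum_(0 <= p < j.+1) (derive1 (leibniz_coef h j p) x * derive1n p w x +
    leibniz_coef h j p x * derive1n p.+1 w x)).
  rewrite derive1E (_ : (fun y => _) = \sum_(p < j.+1)
      (fun y => leibniz_coef h j p y * derive1n p w y)); last first.
    by apply/funext => y; rewrite fct_sumE big_mkord.
  rewrite derive_sum // big_mkord; apply: eq_bigr => p _.
  rewrite -derive1E derive1_mul //; apply: smooth_derivable Ox => //.
    exact: smooth_leibniz_coef.
  exact: smooth_derive1n.
rewrite big_split /= [in RHS]big_nat_recl //= addr0.
rewrite [X in X + _]big_nat_recl // -addrA; congr (_ + _).
under [in RHS]eq_bigr do rewrite mulrDl.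
rewrite [in RHS]big_split /=; congr (_ + _).
by rewrite [in RHS]big_nat_recr //= leibniz_coef_gt // derive1_cst mul0r addr0.
Qed.

(** Put $u_i = u_0 w_i$. The Leibniz rule factors the matrix of derivatives of the $u_i$ into that
    of the $w_i$ and a triangular matrix with [u 0] on the diagonal. Since $w_0 = 1$, the first row
    of the former is a unit vector. *)
Lemma wronskian_reduce k u x : (forall y, O y -> u 0%N y != 0) ->
  (forall i, (i < k.+1)%N -> smooth O (u i)) -> O x ->
  wronskian k.+1 u x =
  wronskian k (fun i => derive1 (fun y => u i.+1 y / u 0%N y)) x * u 0%N x ^+ k.+1.
Proof.
move=> u0 us Ox; pose w i y := u i y / u 0%N y.
have ws i : (i < k.+1)%N -> smooth O (w i).
  by move=> ik n; apply: Cn_mul => //; [exact: us|apply: Cn_inv => //; exact: us].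
have w0 j : derive1n j (w 0%N) x = (j == 0%N)%:R.
  elim: j x Ox => [|j IH] y Oy /=; first by rewrite /w divff ?u0.
  have: forall z, O z -> derive1n j (w 0%N) z = (j == 0%N)%:R := IH.
  by move=> /(derive1_ext O_open) ->; rewrite // derive1_cst.
rewrite {1}/wronskian.
rewrite (@ldet_mul_triangular _ _ _ (fun i j => derive1n j (w i) x)
  (fun p j => leibniz_coef (u 0%N) j p x)).
- rewrite ldet_unit_row; [|by rewrite w0|by move=> j _; rewrite w0].
  congr (_ * _).
    by apply: eq_ldet => i j _ _; rewrite derive1Sn.
  rewrite (eq_bigr (fun=> u 0%N x)) ?prodr_const ?card_ord // => j _.
  by rewrite leibniz_coef_diag.
- by move=> p j /andP[jp _]; rewrite leibniz_coef_gt.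
- move=> i j ik jk.
  have e : forall y, O y -> u i y = u 0%N y * w i y.
    by move=> y Oy; rewrite mulrC divfK ?u0.
  have -> : derive1n j (u i) x = derive1n j (fun y => u 0%N y * w i y) x.
    elim: j x Ox {jk w0} => [|j IH] y Oy; first exact: e.
    exact: (derive1_ext O_open IH Oy).
  rewrite leibniz //; [|exact: us|exact: ws].
  rewrite [RHS](big_cat_nat (n := j.+1)) //= [X in _ + X]big1_seq ?addr0.
    by apply: eq_bigr => p _; rewrite mulrC.
  move=> p /andP[_]; rewrite mem_index_iota => /andP[jp _].
  by rewrite leibniz_coef_gt // mulr0.
Qed.

End Wronskian.

Section Chebyshev.
Variable R : realType.
Implicit Types (f : R -> R) (u v : nat -> R -> R) (e : nat -> R) (O : set R).

(** For fixed coefficients the mean value theorem for the combination [F] of the [v i] turns an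
    increment over the [j]-th interval into a derivative at one interior point. Since columns are
    exchanged one at a time, the point may depend on the other columns. *)
Lemma ldet_increments_gt0 k (c : R) v (s t : nat -> R) :
  (forall i j x, (i < k)%N -> (j < k)%N -> s j <= x <= t j -> derivable (v i) x 1) ->
  (forall j, (j < k)%N -> s j < t j) ->
  (forall p : nat -> R, (forall j, (j < k)%N -> s j < p j < t j) ->
     0 < c * ldet k (fun i j => derive1 (v i) (p j))) ->
  0 < c * ldet k (fun i j => v i (t j) - v i (s j)).
Proof.
move=> dv st pos.
apply: (@ldet_expand_pos _ _ (fun j x => s j < x < t j) (fun i x => derive1 (v i) x)) => //; last first.
  by exists (fun j => (s j + t j) / 2) => j jk; rewrite !midf_lt ?st.
move=> a j jk apos; pose F x := \sum_(i < k) v i x * a i.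
have dF x : s j <= x <= t j ->
    is_derive x 1 F (\sum_(i < k) derive1 (v i) x * a i).
  move=> xst; rewrite (_ : F = \sum_(i < k) (fun x => v i x * a i)); last first.
    by apply/funext => y; rewrite fct_sumE.
  apply: is_derive_sum => i.
  have dvi := dv i j x (ltn_ord i) jk xst.
  have -> : (fun x => v i x * a i) = (a i \*: v i) by apply/funext => y; rewrite /= [RHS]mulrC.
  have dvi' : is_derive x 1 (v i) (derive1 (v i) x) by rewrite derive1E; exact: derivableP.
  by rewrite mulrC; exact: is_deriveZ.
have [| |x xst FE] := @MVT R F (fun x => \sum_(i < k) derive1 (v i) x * a i) _ _ (st j jk).
- by move=> x; rewrite in_itv /= => /andP[sx xt]; apply: dF; rewrite !ltW.
- apply: derivable_within_continuous => x; rewrite in_itv /= => xst.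
  by have [] := dF x xst.
rewrite in_itv /= in xst.
have -> : \sum_(i < k) (v i (t j) - v i (s j)) * a i = F (t j) - F (s j).
  by rewrite /F -sumrB; apply: eq_bigr => i _; rewrite mulrBl.
by rewrite FE mulr_gt0 ?apos // subr_gt0 st.
Qed.

(** Induction on [k]. Division by [u 0] and differences of neighbouring columns leave increments of
    the quotients [w i], which reduce to determinants of their derivatives. By [wronskian_reduce]
    the Wronskians of these derivatives inherit their signs from those of [u]. *)
Lemma wronskian_chebyshev k O u e : open O -> is_interval O ->
  (forall i, (i < k)%N -> smooth O (u i)) ->
  (forall m x, (0 < m <= k)%N -> O x -> 0 < e m * wronskian m u x) ->
  forall p : nat -> R, (0 < k)%N -> (forall i j, (i < j < k)%N -> p i < p j) ->
    (forall j, (j < k)%N -> O (p j)) ->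
    0 < e k * ldet k (fun i j => u i (p j)).
Proof.
move=> O_open O_itv; elim: k u e => // k IH u e us W p _ p_incr pO.
have e1u x : O x -> 0 < e 1%N * u 0%N x.
  by move=> Ox; have := W 1%N x isT Ox; rewrite /wronskian ldet1.
have u0 x : O x -> u 0%N x != 0.
  by move=> /e1u; apply: contraTneq => ->; rewrite mulr0 ltxx.
have e1 : e 1%N != 0.
  by have := e1u _ (pO 0%N isT); apply: contraTneq => ->; rewrite mul0r ltxx.
rewrite (@ldet_quotient_sign _ _ _ _ (e 1%N)); last by move=> j jk; exact/e1u/pO.
case: k IH us W p_incr pO => [|k] IH us W p_incr pO.
  by rewrite /ldet det_mx00 mulr1 expr1 -expr2 exprn_even_gt0.
pose w i x := u i.+1 x / u 0%N x.
have ws i : (i < k.+1)%N -> smooth O (w i).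
  by move=> ik n; apply: Cn_mul => //; [exact: us|apply: Cn_inv => //; exact: us].
have between j x : (j < k.+1)%N -> p j <= x <= p j.+1 -> O x.
  by move=> jk; apply: O_itv; apply: pO; rewrite ?ltnS // ltnW.
apply: (@ldet_increments_gt0 _ _ w p (fun j => p j.+1)).
- move=> i j x ik jk pxp; exact: smooth_derivable (ws i ik) (between _ _ jk pxp).
- by move=> j jk; rewrite p_incr // ltnSn ltnS.
move=> q pq.
apply: (IH (fun i => derive1 (w i)) (fun m => e m.+1 * e 1%N ^+ m.+1)) => //.
- by move=> i ik; apply/smooth_derive1/ws.
- move=> m x /andP[m0 mk] Ox.
  have := W m.+1 x mk Ox; rewrite (wronskian_reduce O_open u0) //.
    move=> pos.
    have e2 : 0 < e 1%N ^+ m.+1 * u 0%N x ^+ m.+1 by rewrite -exprMn exprn_gt0 // e1u.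
    have e4 : 0 < u 0%N x ^+ m.+1 ^+ 2 by rewrite exprn_even_gt0 //= expf_neq0 // u0.
    rewrite -(pmulr_lgt0 _ e4).
    set W' := wronskian m _ x in pos *; set U := u 0%N x ^+ m.+1 in pos e2 e4 *.
    have -> : e m.+1 * e 1%N ^+ m.+1 * W' * U ^+ 2 = (e 1%N ^+ m.+1 * U) * (e m.+1 * (W' * U)).
      by ring.
    by rewrite mulr_gt0.
  by move=> i im; apply: us; lia.
- move=> i j /andP[ij jk]; have /andP[_ h1] := pq i (ltn_trans ij jk).
  have /andP[h2 _] := pq j jk; apply: (lt_le_trans h1); apply: le_trans (ltW h2).
  move: ij; rewrite leq_eqVlt => /orP[/eqP -> //|ij]; rewrite ltW // p_incr // ij /=.
  exact: ltnW.
- by move=> j jk; apply: (between j) => //; have /andP[h1 h2] := pq j jk; rewrite !ltW.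
Qed.

End Chebyshev.

Section Kernel.
Variable R : realType.
Implicit Types (f : R -> R) (e : nat -> R).

Lemma derive1n_shift f a j : derive1n j (fun t => f (a + t)) = (fun t => derive1n j f (a + t)).
Proof.
elim: j => // j IH; rewrite derive1nS IH; apply/funext => t.
rewrite derive1nS /derive1.
have -> : (fun h => h^-1 *: (derive1n j f (a + (h + t)) - derive1n j f (a + t))) =
    (fun h => h^-1 *: (derive1n j f (h + (a + t)) - derive1n j f (a + t))).
  by apply/funext => h; rewrite addrCA.
by [].
Qed.

Lemma derivable_shift f a t : derivable f (a + t) 1 -> derivable (fun t => f (a + t)) t 1.
Proof.
move=> df; have -> : (fun t => f (a + t)) = (fun t => f (t - (- a))).
  by apply/funext => y; rewrite opprK addrC.
have dd : is_derive (t - (- a)) 1 f (derive1 f (t - (- a))).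
  by rewrite opprK [t + a]addrC derive1E; exact: derivableP.
by have [] := is_derive_center dd.
Qed.

(* The Wronskian criterion is used twice: for the functions [derive1n i f''],
   and then, with fixed [p j], for the functions [fun t => f'' (p j + t)]. *)
Lemma hankel_kernel n (r : R) f e :
  (forall x m, 0 < x < r -> derivable (derive1n m f) x 1) ->
  (forall k x, (0 < k <= n)%N -> 0 < x < r ->
     0 < e k * ldet k (fun i j => derive1n (i + j).+2 f x)) ->
  sign_regular_kernel n r f e.
Proof.
move=> df H; set phi := derive1n 2 f.
have itvO a b : is_interval [set x : R | a < x < b].
  move=> x y /= /andP[ax xb] /andP[ay yb] z /andP[xz zy].
  by rewrite (lt_le_trans ax) ?(le_lt_trans zy).
have openO a b : open [set x : R | a < x < b].
  rewrite (_ : mkset _ = `]a, b[%classic); first exact: interval_open.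
  by apply/seteqP; split=> x /=; rewrite in_itv.
have smooth_f : forall m, smooth [set x | 0 < x < r] (derive1n m f).
  move=> m k; elim: k m => //= k IH m; split=> [x xr|]; first exact: df.
  exact: (IH m.+1).
have stage1 k (y : nat -> R) : (0 < k <= n)%N -> (forall i j, (i < j < k)%N -> y i < y j) ->
    (forall j, (j < k)%N -> 0 < y j < r) ->
    0 < e k * ldet k (fun i j => derive1n i phi (y j)).
  move=> /andP[k0 kn] y_incr yr.
  apply: (@wronskian_chebyshev _ k [set x | 0 < x < r] (fun i => derive1n i phi) e) => //.
  - by move=> i _; rewrite /phi /derive1n -iterD; exact: smooth_f.
  - move=> m x /andP[m0 mk] xr.
    rewrite /wronskian (@eq_ldet _ _ _ (fun i j => derive1n (i + j).+2 f x)).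
      by apply: H; rewrite ?m0 ?(leq_trans mk kn).
    by move=> i j _ _; rewrite /phi /derive1n -!iterD; congr (iter _ _ _ _); lia.
have stage2 k (y h : nat -> R) : (0 < k <= n)%N -> (forall i j, (i < j < k)%N -> y i < y j) ->
    (forall i j, (i < j < k)%N -> h i < h j) -> 0 < y 0%N + h 0%N ->
    y k.-1 + h k.-1 < r -> 0 < e k * ldet k (fun i j => phi (y j + h i)).
  move=> /andP[k0 kn] y_incr h_incr yh0 yhr.
  have mono (z : nat -> R) i j : (forall i j, (i < j < k)%N -> z i < z j) ->
      (i <= j)%N -> (j < k)%N -> z i <= z j.
    move=> z_incr; rewrite leq_eqVlt => /orP[/eqP ->//|ij] jk.
    by rewrite ltW // z_incr ?ij.
  have k1 : (k.-1 < k)%N by rewrite prednK.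
  have range i t : (i < k)%N -> - y 0%N < t < r - y k.-1 -> 0 < y i + t < r.
    move=> ik /andP[t0 t1]; have y0 := mono y 0%N i y_incr (leq0n _) ik.
    have y1 : y i <= y k.-1 by apply: mono => //; lia.
    lra.
  have -> : ldet k (fun i j => phi (y j + h i)) = ldet k (fun i j => phi (y i + h j)).
    exact: (ldet_tr k (fun i j => phi (y i + h j))).
  apply: (@wronskian_chebyshev _ k [set t | - y 0%N < t < r - y k.-1]
    (fun i t => phi (y i + t)) e) => //.
  - move=> i ik m.
    have : smooth [set t | - y 0%N < t < r - y k.-1] (fun t => phi (y i + t)).
      rewrite /smooth => {}m; rewrite /phi; elim: m 2%N => //= m IH q; split.
        move=> t tr; apply: (derivable_shift (f := derive1n q f)).
        by apply: df; exact: range.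
      by have := derive1n_shift (derive1n q f) (y i) 1 => /= ->; exact: (IH q.+1).
    exact.
  - move=> m t /andP[m0 mk] tr.
    have := stage1 m (fun i => y i + t).
    rewrite m0 (leq_trans mk kn) => /(_ isT) s1.
    rewrite /wronskian.
    have -> : ldet m (fun i j => derive1n j (fun t => phi (y i + t)) t) =
        ldet m (fun i j => derive1n i phi (y j + t)).
      transitivity (ldet m (fun i j => derive1n j phi (y i + t))).
        apply: eq_ldet => i j _ _.
        exact: (congr1 (fun F => F t) (derive1n_shift phi (y i) j)).
      exact: (ldet_tr m (fun i j => derive1n i phi (y j + t))).
    apply: s1.
      by move=> i j ijm; rewrite ltrD2r y_incr //; lia.
    by move=> j jm; apply: range => //; lia.
  - move=> j jk; have h0 := mono h 0%N j h_incr (leq0n _) jk.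
    have h1 : h j <= h k.-1 by apply: mono => //; lia.
    by rewrite /=; lra.
move=> k d x /[dup] k0n /andP[k0 kn] d_incr d0 x_incr x0 xr.
have k1 : (k.-1 < k)%N by rewrite prednK.
have x_le i j : (i <= j <= k)%N -> x i <= x j.
  by move=> /andP[]; rewrite leq_eqVlt => /orP[/eqP ->//|ij] jk; rewrite ltW // x_incr ?ij.
have d_le i : (i < k)%N -> d i <= d k.-1.
  move=> ik; have : (i <= k.-1)%N by lia.
  by rewrite leq_eqVlt => /orP[/eqP ->//|ij]; rewrite ltW // d_incr ?ij.
have d_gt0 i : (i < k)%N -> 0 < d i.
  by case: i => // i ik; apply: lt_trans d0 (d_incr 0%N i.+1 ik).
have df0 z : 0 < z < r -> derivable f z 1 := @df z 0%N.
have df1 z : 0 < z < r -> derivable (derive1 f) z 1 := @df z 1%N.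
have range i j z : (i < k)%N -> (j < k)%N -> x j <= z <= x j.+1 ->
    0 < z < r /\ 0 < d i + z < r.
  move=> ik jk /andP[xz zx]; have h1 := x_le 0%N j; have h2 := x_le j.+1 k.
  have := d_le i ik; have := d_gt0 i ik.
  rewrite (ltnW jk) /= in h1; rewrite jk leqnn /= in h2.
  move: (h1 isT) (h2 isT); lra.
(* First mean value argument, in the variable [x]: the columns become derivatives at points [p j]
   between neighbouring [x]. *)
apply: (@ldet_increments_gt0 _ _ _ (fun i t => f (t + d i) - f t) x (fun j => x j.+1)).
- move=> i j z ik jk /(range i j z ik jk)[zr dzr]; apply: derivableB; last exact: df0.
  rewrite (_ : (fun t => f (t + d i)) = (fun t => f (d i + t))).
    by apply: derivable_shift; exact: df0.
  by apply/funext => t; rewrite addrC.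
- by move=> j jk; rewrite x_incr // ltnSn.
move=> p xpx.
(* Prepending the shift 0 makes $f'(p + d_i) - f'(p)$ an increment from [D 0]. Passing to
   consecutive increments prepares the second mean value argument, in the shifts. *)
pose D i : R := if i is i'.+1 then d i' else 0.
pose g l t := derive1 f (p l + t).
have prange l : (l < k)%N -> x l <= p l <= x l.+1.
  by move=> lk; have /andP[h1 h2] := xpx l lk; rewrite !ltW.
have D_incr i : (i < k)%N -> D i < D i.+1.
  by case: i => [|i] ik; [exact: d0|apply: d_incr; rewrite ltnSn].
have -> : ldet k (fun i j => derive1 (fun t => f (t + d i) - f t) (p j)) =
    ldet k (fun l i => g l (D i.+1) - g l (D i)).
  rewrite -(ldet_increments_from0 k (fun l i => g l (D i))).
  transitivity (ldet k (fun i j => g j (D i.+1) - g j (D 0%N))); last first.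
    exact: (ldet_tr k (fun l i => g l (D i.+1) - g l (D 0%N))).
  apply: eq_ldet => i j ik jk; have [zr dzr] := range i j (p j) ik jk (prange j jk).
  have shiftE : (fun t => f (t + d i)) = (fun t => f (d i + t)).
    by apply/funext => t; rewrite addrC.
  have dshift : derivable (fun t => f (t + d i)) (p j) 1.
    by rewrite shiftE; apply: derivable_shift; exact: df0.
  rewrite derive1E (deriveB dshift (df0 _ zr)) -!derive1E shiftE /g /= addr0.
  congr (_ - _); rewrite addrC.
  have := congr1 (fun F => F (p j)) (derive1n_shift f (d i) 1).
  by rewrite /= addrC.
apply: (@ldet_increments_gt0 _ _ _ g D (fun i => D i.+1)) => [l i t lk ik /andP[Dt tD]|//|q Dq].
  apply: (derivable_shift (f := derive1 f)); apply: df1.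
  have [zr _] := range i l (p l) ik lk (prange l lk).
  have [_ dzr] := range i l (p l) ik lk (prange l lk).
  have D0 : 0 <= D i by case: (i) ik => // i' ik'; apply/ltW/d_gt0/ltnW.
  move: zr dzr; rewrite /= in tD; lra.
have -> : ldet k (fun l i => derive1 (g l) (q i)) = ldet k (fun i l => phi (p l + q i)).
  transitivity (ldet k (fun l i => phi (p l + q i))).
    apply: eq_ldet => l i _ _.
    exact: (congr1 (fun F => F (q i)) (derive1n_shift (derive1 f) (p l) 1)).
  exact: (ldet_tr k (fun i l => phi (p l + q i))).
have chain (z z' : nat -> R) : (forall j, (j < k)%N -> z j < z' j < z j.+1) ->
    (forall i j, (i <= j <= k)%N -> z i <= z j) ->
    forall i j, (i < j < k)%N -> z' i < z' j.
  move=> zz' z_le i j /andP[ij jk]; have /andP[_ h1] := zz' i (ltn_trans ij jk).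
  have /andP[h2 _] := zz' j jk; apply: (lt_le_trans h1); apply: le_trans (ltW h2).
  by apply: z_le; rewrite ij ltnW.
have D_le i j : (i <= j <= k)%N -> D i <= D j.
  elim: j => [|j IH]; first by rewrite leqn0 => /andP[/eqP ->].
  move=> /andP[]; rewrite leq_eqVlt => /orP[/eqP ->//|ij] jk.
  by apply: le_trans (ltW (D_incr j jk)); apply: IH; rewrite -ltnS ij ltnW.
apply: stage2 => //.
- exact: chain x_le.
- exact: chain D_le.
- have /andP[h1 _] := xpx 0%N k0; have /andP[h2 _] := Dq 0%N k0.
  by move: h2; rewrite /=; lra.
- have /andP[_ h1] := xpx _ k1; have /andP[_ h2] := Dq _ k1.
  by rewrite prednK // in h1; move: h2; rewrite /=; lra.
Qed.

End Kernel.

(** * Singular Hankel determinants *)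

Section Cofactors.
Variable R : realFieldType.
Implicit Types M : nat -> nat -> R.

Definition last_cofactor m M j : R :=
  (-1) ^+ (m + j) * ldet m (fun a l => M a (bump j l)).

(** Entry [(i, m)] of the product of a matrix with its adjugate. *)
Lemma sum_last_cofactor m M i : (i <= m)%N ->
  \sum_(0 <= j < m.+1) M i j * last_cofactor m M j =
  if i == m then ldet m.+1 M else 0.
Proof.
move=> im; pose A := \matrix_(i < m.+1, j < m.+1) M i j.
have := congr1 (fun B : 'M[R]_(m.+1) => B (inord i) ord_max) (mul_mx_adj A).
rewrite !mxE -(inj_eq val_inj) /= inordK // => e.
transitivity (\det A *+ (i == m)); last by case: eqP.
rewrite -e big_mkord; apply: eq_bigr => j _; rewrite !mxE inordK // /cofactor.
congr (_ * (_ * \det _)); apply/matrixP => a l; rewrite !mxE /=.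
by rewrite -[bump m a]/(lift ord_max a : nat) lift_max.
Qed.

Lemma last_cofactor_diag m M : last_cofactor m M m = ldet m M.
Proof.
rewrite /last_cofactor addnn -mul2n exprM sqrrN expr1n expr1n mul1r.
by apply: eq_ldet => i j _ jm; rewrite /bump leqNgt jm.
Qed.

Lemma ldet_kernel m M (v : nat -> R) : ldet m M != 0 ->
  (forall i, (i < m)%N -> \sum_(0 <= j < m) M i j * v j = 0) ->
  forall j, (j < m)%N -> v j = 0.
Proof.
move=> M0 Mv j jm; pose A := \matrix_(i < m, j < m) M i j.
pose w := \col_(j < m) v j.
have Au : A \in unitmx by rewrite unitmxE unitfE.
have Aw : A *m w = 0.
  apply/matrixP => i l; rewrite !mxE -[RHS](Mv i) // big_mkord.
  by apply: eq_bigr => p _; rewrite !mxE.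
have := mulKmx Au w; rewrite Aw mulmx0 => /matrixP/(_ (Ordinal jm) ord0).
by rewrite !mxE.
Qed.

End Cofactors.

Section ConstantCoefficients.
Variable R : realType.
Implicit Types (f g : R -> R).

Lemma constant_of_derive0 g (r : R) :
  (forall x, 0 < x < r -> is_derive x 1 g 0) ->
  forall x y, 0 < x < r -> 0 < y < r -> g x = g y.
Proof.
move=> dg; suff lt_case x y : 0 < x < r -> 0 < y < r -> x < y -> g x = g y.
  move=> x y xr yr; case: (ltgtP x y) => [xy|yx|->//]; first exact: lt_case.
  exact/esym/lt_case.
move=> /andP[x0 xr] /andP[y0 yr] xy.
have [| |z _] := @MVT R g (fun=> 0) x y xy.
- by move=> z; rewrite in_itv /= => /andP[xz zy]; apply: dg; lra.
- apply: derivable_within_continuous => z; rewrite in_itv /= => /andP[xz zy].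
  have zr : 0 < z < r by lra.
  by have [] := dg z zr.
by rewrite mul0r => /eqP; rewrite subr_eq0 => /eqP.
Qed.

(** The left side of the conclusion is the derivative of a quotient as the rules for products and
    inverses produce it. *)
Lemma quotient_eq0 (p p' s s' : R) : s != 0 -> p' * s - p * s' = 0 ->
  p * (- s ^- 2 * s') + s^-1 * p' = 0.
Proof.
move=> s0 e; rewrite (_ : _ + _ = (p' * s - p * s') / s ^+ 2); last by field.
by rewrite e mul0r.
Qed.

Lemma cancel_ratio (u v s : R) : s != 0 -> - (u * v) = - (v / s) * u * s.
Proof. by move=> s0; field. Qed.

Definition hankel k f x : R := ldet k (fun i j => derive1n (i + j).+2 f x).

Lemma analytic_at_hankel k f x : analytic_at f x -> analytic_at (hankel k f) x.
Proof.
by move=> fx; apply: analytic_at_ldet => i j _ _; exact: analytic_at_derive1n.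
Qed.

(* The last row of cofactors spans the kernel of the singular Hankel matrix,
   and so does its derivative; hence the ratios of the cofactors are constant. *)
Lemma hankel_ode m f (r : R) : (forall x, 0 < x < r -> analytic_at f x) ->
  (forall x, 0 < x < r -> hankel m.+1 f x = 0) ->
  (forall x, 0 < x < r -> hankel m f x != 0) ->
  exists b : nat -> R, forall x, 0 < x < r ->
    derive1n m.+2 f x = \sum_(0 <= j < m) b j * derive1n j.+2 f x.
Proof.
move=> fan H0 Hn0.
pose M x i j := derive1n (i + j).+2 f x.
pose c j x := last_cofactor m (M x) j.
have can j x : 0 < x < r -> analytic_at (c j) x.
  move=> xr; apply: analytic_atM; first exact: analytic_at_cst.
  apply: (analytic_at_ldet (M := fun a l x => M x a (bump j l))) => a l _ _.
  exact/analytic_at_derive1n/fan.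
have cd j x : 0 < x < r -> is_derive x 1 (c j) (derive1 (c j) x).
  by move=> xr; rewrite derive1E; apply/derivableP/analytic_at_derivable/can.
have Md i j x : 0 < x < r -> is_derive x 1 (fun y => M y i j) (M x i.+1 j).
  move=> xr; have -> : M x i.+1 j = derive1 (fun y => M y i j) x by rewrite /M addSn.
  rewrite derive1E.
  exact/derivableP/analytic_at_derivable/analytic_at_derive1n/fan.
have ker i x : (i <= m)%N -> 0 < x < r -> \sum_(0 <= j < m.+1) M x i j * c j x = 0.
  by move=> im xr; rewrite /c sum_last_cofactor //; case: eqP => // _; exact: H0.
have openO : open [set x : R | 0 < x < r].
  rewrite (_ : mkset _ = `]0, r[%classic); first exact: interval_open.
  by apply/seteqP; split=> x /=; rewrite in_itv.
(* Differentiating relation [i] of [ker] produces relation [i.+1] as an extra term, because the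
   derivative of row [i] of a Hankel matrix is row [i.+1]. *)
have ker' i x : (i < m)%N -> 0 < x < r ->
    \sum_(0 <= j < m.+1) M x i j * derive1 (c j) x = 0.
  move=> im xr; have d0 : derive1 (fun y => \sum_(0 <= j < m.+1) M y i j * c j y) x = 0.
    by rewrite (derive1_ext openO (g := fun=> 0)) ?derive1_cst // => y yr; rewrite ker // ltnW.
  rewrite -[RHS]d0 derive1E (_ : (fun y => _) = \sum_(j < m.+1) (fun y => M y i j * c j y)); last first.
    by apply/funext => y; rewrite fct_sumE big_mkord.
  have dj (j : 'I_m.+1) : is_derive x 1 (fun y => M y i j * c j y)
      (M x i j * derive1 (c j) x + M x i.+1 j * c j x).
    apply: (is_derive_eq (is_deriveM (Md i j x xr) (cd j x xr))).
    by congr (_ + _); exact: mulrC.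
  have [_ ->] := is_derive_sum dj.
  rewrite big_split /= (_ : \sum_(j < m.+1) M x i.+1 j * c j x = 0); last first.
    by rewrite -(big_mkord xpredT (fun j => M x i.+1 j * c j x)) ker.
  by rewrite addr0 big_mkord.
(* The numerator of the derivative of [c j / c m]. Its last entry cancels, so the first [m] entries
   are annihilated by the nonsingular minor of size [m]. *)
pose w j x := derive1 (c j) x * c m x - c j x * derive1 (c m) x.
have cm x : c m x = hankel m f x by rewrite /c last_cofactor_diag.
have w0 j x : (j < m)%N -> 0 < x < r -> w j x = 0.
  move=> jm xr; apply: (@ldet_kernel _ m (M x) (w^~ x)) => // [|i im]; first exact: Hn0.
  have := ker' i x im xr; rewrite big_nat_recr //= => /(congr1 (fun t => t * c m x)).
  have := ker i x (ltnW im) xr; rewrite big_nat_recr //= => /(congr1 (fun t => t * derive1 (c m) x)).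
  rewrite !mul0r !mulrDl !mulr_suml => e1 e2.
  transitivity (\sum_(0 <= j < m) M x i j * derive1 (c j) x * c m x -
                \sum_(0 <= j < m) M x i j * c j x * derive1 (c m) x).
    by rewrite -sumrB; apply: eq_bigr => l _; rewrite /w mulrBr !mulrA.
  move: e1 e2; set s1 := \sum_(_ <= _ < _) _; set s2 := \sum_(_ <= _ < _) _ => e1 e2.
  have : s2 - s1 = (s2 + M x i m * derive1 (c m) x * c m x) - (s1 + M x i m * c m x * derive1 (c m) x).
    by ring.
  by rewrite e1 e2 subrr.
pose q j x := c j x / c m x.
have q_cst j x y : (j < m)%N -> 0 < x < r -> 0 < y < r -> q j x = q j y.
  move=> jm xr yr; apply: (@constant_of_derive0 _ r) xr yr => z zr.
  have cz : c m z != 0 by rewrite cm Hn0.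
  apply: (is_derive_eq (is_deriveM (cd j z zr) (is_deriveV cz (cd m z zr)))).
  exact: (quotient_eq0 cz (w0 j z jm zr)).
have [r0|r0] := ltP 0 r; last by exists (fun=> 0) => x; lra.
exists (fun j => - q j (r / 2)) => x xr.
have := ker 0%N x (leq0n m) xr; rewrite big_nat_recr //= => /eqP.
rewrite addrC addr_eq0 => /eqP e.
have cx : c m x != 0 by rewrite cm Hn0.
apply: (mulIf cx); transitivity (M x 0%N m * c m x); first by [].
rewrite e mulr_suml -sumrN.
rewrite big_seq [RHS]big_seq; apply: eq_bigr => j; rewrite mem_index_iota => /andP[_ jm].
rewrite (q_cst j (r / 2) x) //; last by lra.
exact: (cancel_ratio (M x 0%N j) (c j x) cx).
Qed.

End ConstantCoefficients.

(** * Dependence of differences under a linear differential equation *)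

Section Dependence.
Variable R : realType.
Implicit Types (f g : R -> R) (J : set R).

Lemma nontrivial_combination n m (E : nat -> 'I_n -> R) : (m < n)%N ->
  exists2 c : 'I_n -> R, (exists i, c i != 0) &
    forall s, (s < m)%N -> \sum_(i < n) c i * E s i = 0.
Proof.
move=> mn; pose A := \matrix_(i < n, s < m) E s i.
have : kermx A != 0.
  by rewrite kermx_eq0 /row_free neq_ltn (leq_ltn_trans (rank_leq_col A)).
move=> /rowV0Pn[v /sub_kermxP vA v0].
have /existsP[i vi] : [exists i, v 0 i != 0].
  rewrite -negb_forall; apply: contra v0 => /forallP v0.
  by apply/eqP/rowP => i; rewrite mxE; apply/eqP.
exists (v 0); first by exists i.
move=> s sm; have := congr1 (fun B : 'rV[R]_m => B 0 (Ordinal sm)) vA.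
by rewrite !mxE => e; rewrite -[RHS]e; apply: eq_bigr => l _; rewrite mxE.
Qed.

Lemma sub_swap (u v s t : R) : u - v = s - t -> u - s = v - t.
Proof. lra. Qed.

Lemma is_derive_lincomb N (a : 'I_N -> R) (h : 'I_N -> R -> R) (dh : 'I_N -> R) (x : R) :
  (forall i, is_derive x 1 (h i) (dh i)) ->
  is_derive x 1 (fun t => \sum_(i < N) a i * h i t) (\sum_(i < N) a i * dh i).
Proof.
move=> Dh; rewrite (_ : (fun t => _) = \sum_(i < N) (fun t => a i * h i t)).
  by apply: is_derive_sum => i; exact: is_deriveZ.
by apply/funext => t; rewrite fct_sumE.
Qed.

Lemma delta_dependent n m f J (b : nat -> R) (r L : R) :
  open J -> is_interval J -> (forall x, J x -> analytic_at f x) ->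
  0 < r -> (forall x, 0 < x < r -> J x) -> (m < n)%N -> 0 < L ->
  (forall x, 0 < x < r ->
     derive1n m.+2 f x = \sum_(0 <= j < m) b j * derive1n j.+2 f x) ->
  exists d : 'I_n -> R, [/\ injective d, forall i, 0 < d i < L &
    ~ one_independent (Delta_dom J d) (fun i => Delta (d i) f)].
Proof.
move=> J_open J_itv fan r0 rJ mn L0 ode.
(* With shifts below [r / 4] all the points [x0 + d i] stay below [r / 2], so the differential
   equation is available wherever it is evaluated. *)
pose F s := derive1n s f; pose x0 := r / 4; pose h := Num.min L (r / 4).
have h0 : 0 < h by rewrite lt_min L0 divr_gt0.
pose d (i : 'I_n) : R := h * (i.+1%:R / n.+1%:R).
have d_h i : 0 < d i < h.
  rewrite mulr_gt0 ?divr_gt0 ?ltr0n //= gtr_pMr // ltr_pdivrMr ?ltr0n // mul1r ltr_nat ltnS.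
  exact: ltn_ord.
have d_inj : injective d.
  move=> i j /(mulfI (lt0r_neq0 h0))/(mulIf _) e; apply/val_inj/eqP.
  by rewrite -eqSS -(eqr_nat R); apply/eqP/e; rewrite invr_eq0 pnatr_eq0.
exists d; split=> // [i|].
  by have /andP[-> /lt_le_trans] := d_h i; apply; rewrite ge_min lexx.
have d_r i : 0 < d i < r / 4.
  by have /andP[-> /lt_le_trans] := d_h i; apply; rewrite ge_min lexx orbT.
have Fan s x : J x -> analytic_at (F s) x by move=> /fan; exact: analytic_at_derive1n.
have Fd s x : J x -> is_derive x 1 (F s) (F s.+1 x).
  by move=> Jx; rewrite /F derive1nS derive1E; apply/derivableP/analytic_at_derivable/Fan.
have openO a : open [set x : R | 0 < x < a].
  rewrite (_ : mkset _ = `]0, a[%classic); first exact: interval_open.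
  by apply/seteqP; split=> x /=; rewrite in_itv.
have ode_t t x : 0 < x < r ->
    F (m + t).+2 x = \sum_(j < m) b j * F (j + t).+2 x.
  elim: t x => [|t IH] x xr.
    rewrite addn0 -[LHS]/(derive1n m.+2 f x) ode // big_mkord.
    by apply: eq_bigr => j _; rewrite addn0.
  rewrite addnS -[LHS]/(derive1 (F (m + t).+2) x) (derive1_ext (openO r) IH xr) derive1E.
  have [_ ->] := is_derive_lincomb (fun j : 'I_m => b j)
    (fun j : 'I_m => Fd (j + t).+2 x (rJ x xr)).
  by apply: eq_bigr => j _; rewrite addnS.
pose E s i := F s.+1 (d i + x0) - F s.+1 x0.
(* The equation relates derivatives from the second one on. Its antiderivative [g] is constant, and
   comparing its values at two points lowers every order by one. *)
have E_rec t i : E (m + t)%N i = \sum_(j < m) b j * E (j + t)%N i.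
  pose g x := F (m + t).+1 x - \sum_(j < m) b j * F (j + t).+1 x.
  have : g (d i + x0) = g x0.
    apply: (@constant_of_derive0 _ _ r) => [x xr||].
    - have D := is_derive_lincomb (fun j : 'I_m => b j)
        (fun j : 'I_m => Fd (j + t).+1 x (rJ x xr)).
      have := is_deriveB (Fd (m + t).+1 x (rJ x xr)) D.
      by rewrite ode_t // subrr.
    - by have := d_r i; rewrite /x0; lra.
    - by rewrite /x0; lra.
  move=> /sub_swap eg; rewrite /E eg -sumrB.
  by apply: eq_bigr => j _; rewrite mulrBr.
(* There are [n] unknowns and only [m < n] conditions; the recurrence then extends the vanishing to
   all orders. *)
have [c [i0 ci0] cE] := nontrivial_combination E mn.
have cE0 s : \sum_(i < n) c i * E s i = 0.
  elim/ltn_ind: s => s IH; have [sm|ms] := ltnP s m; first exact: cE.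
  rewrite -(subnKC ms); under eq_bigr do rewrite E_rec mulr_sumr.
  rewrite exchange_big /= big1 // => j _.
  under eq_bigr do rewrite mulrCA.
  rewrite -mulr_sumr IH ?mulr0 //; have := ltn_ord j; lia.
(* The same combination of the derivatives of the [Delta (d i) f]. It is flat at [x0], and the
   common domain is an interval, so it vanishes there identically. *)
pose G x := \sum_(i < n) c i * (F 1%N (x + d i) - F 1%N x).
have Gan x : Delta_dom J d x -> analytic_at G x.
  move=> [Jx Jxd]; apply: analytic_at_sum => i _.
  apply: analytic_atM; first exact: analytic_at_cst.
  rewrite (_ : (fun x => _) = (fun y => F 1%N (y + d i) + -1 * F 1%N y)); last first.
    by apply/funext => y; rewrite mulN1r.
  apply: analytic_atD; first by apply/analytic_at_shift/Fan/Jxd.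
  by apply: analytic_atM; [exact: analytic_at_cst|exact: Fan].
have Gd s x : 0 < x < r / 2 -> derive1n s G x =
    \sum_(i < n) c i * (F s.+1 (x + d i) - F s.+1 x).
  elim: s x => // s IH x xr.
  have xr' : 0 < x < r by lra.
  have xd i : 0 < x + d i < r by have := d_r i; lra.
  have D i : is_derive x 1 (fun y => F s.+1 (y + d i) - F s.+1 y)
      (F s.+2 (x + d i) - F s.+2 x).
    have D1 : is_derive x 1 (fun y => F s.+1 (y - - d i)) (F s.+2 (x - - d i)).
      by apply: is_derive_center; apply: Fd; rewrite opprK; exact: rJ.
    have D2 := is_deriveB D1 (Fd s.+1 x (rJ x xr')).
    have -> : (fun y => F s.+1 (y + d i) - F s.+1 y) = (fun y => F s.+1 (y - - d i)) - F s.+1.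
      by apply/funext => y; rewrite opprK.
    have -> : x + d i = x - - d i by rewrite opprK.
    exact: D2.
  rewrite derive1nS (derive1_ext (openO (r / 2)) IH xr) derive1E.
  by have [_ ->] := is_derive_lincomb c D.
have x0r : 0 < x0 < r / 2 by rewrite /x0; lra.
have Dx0 : Delta_dom J d x0.
  split; first by apply: rJ; lra.
  by move=> i; apply: rJ; have := d_r i; lra.
have G0 : \forall x \near x0, G x = 0.
  apply: (analytic_at_flat (Gan _ Dx0)) => s; rewrite Gd // -[RHS](cE0 s).
  by apply: eq_bigr => i _; rewrite /E [d i + x0]addrC.
have D_conn : connected (Delta_dom J d).
  apply/connected_intervalP => x y [Jx Jxd] [Jy Jyd] z xz; split.
    exact: J_itv xz.
  by move=> i; apply: (J_itv _ _ (Jxd i) (Jyd i)); rewrite !lerD2r.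
have GD := analytic_identity D_conn Dx0 Gan G0.
move=> /(_ c) ind; move/eqP: ci0; apply; apply: ind => x Dx.
rewrite -[RHS](GD x Dx); apply: eq_bigr => i _; congr (_ * _).
have [Jx Jxd] := Dx.
have D1 : is_derive x 1 (fun y => F 0%N (y - - d i)) (F 1%N (x - - d i)).
  by apply: is_derive_center; apply: Fd; rewrite opprK.
have D2 := is_deriveB D1 (Fd 0%N x Jx).
rewrite derive1E -{2}[d i]opprK.
have -> : Delta (d i) f = (fun y => F 0%N (y - - d i)) - F 0%N.
  by apply/funext => y; rewrite /Delta opprK.
by have [_ ->] := D2.
Qed.

End Dependence.

(** * A sign-regular kernel on a short interval to the right of 0 *)

Section LocalKernel.
Variable R : realType.
Implicit Types (f g : R -> R) (J : set R) (P : R -> Prop).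

Lemma near_right_interval P : (\forall x \near 0^', P x) ->
  exists2 r : R, 0 < r & forall x, 0 < x < r -> P x.
Proof.
rewrite near_withinE => /nbhs_ballP[r /= r0 rP]; exists r => // x /andP[x0 xr].
apply: rP; last by rewrite gt_eqF.
by rewrite /ball /= sub0r normrN gtr0_norm.
Qed.

Lemma nonzero_same_sign g (r : R) : (forall x, 0 < x < r -> derivable g x 1) ->
  (forall x, 0 < x < r -> g x != 0) ->
  forall x y, 0 < x < r -> 0 < y < r -> 0 < g x * g y.
Proof.
move=> gd g0; suff le_case x y : 0 < x < r -> 0 < y < r -> x <= y -> 0 < g x * g y.
  move=> x y xr yr; case: (leP x y) => [xy|/ltW yx]; first exact: le_case.
  by rewrite mulrC; exact: le_case.
move=> xr yr xy; rewrite lt_def mulf_neq0 ?g0 //=; rewrite leNgt; apply/negP => gxy.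
have [| |c] := @IVT R g x y 0 xy.
- apply: derivable_within_continuous => z; rewrite in_itv /= => /andP[xz zy].
  by apply: gd; lra.
- rewrite ge_min le_max; apply/andP; split; apply/orP.
  + have [gx|gx] := lerP (g x) 0; [by left|right].
    by rewrite leNgt; apply: contraTN gxy => gy; rewrite -leNgt mulr_ge0 ?ltW.
  + have [gx|gx] := lerP 0 (g x); [by left|right].
    by rewrite leNgt; apply: contraTN gxy => gy; rewrite -leNgt mulr_le0 ?ltW.
- by rewrite in_itv /= => /andP[xc cy] /eqP; apply/negP/g0; lra.
Qed.

Lemma hankel_radius n f J (L : R) :
  open J -> is_interval J -> (forall x, J x -> analytic_at f x) -> J 0 -> 0 < L ->
  (forall d : 'I_n -> R, injective d -> (forall i, 0 < d i < L) ->
     one_independent (Delta_dom J d) (fun i => Delta (d i) f)) ->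
  exists r, [/\ 0 < r, forall x, 0 < x < r -> J x &
    forall k x, (k <= n)%N -> 0 < x < r -> hankel k f x != 0].
Proof.
move=> J_open J_itv fan J0 L0 ind.
have [rJ rJ0 rJP] : exists2 r : R, 0 < r & forall x, 0 < x < r -> J x.
  by apply: near_right_interval; apply: nbhs_dnbhs; exact: open_nbhs_nbhs.
suff H m : (m <= n)%N -> exists r, [/\ 0 < r, forall x, 0 < x < r -> J x &
    forall k x, (k <= m)%N -> 0 < x < r -> hankel k f x != 0] by exact: H.
elim: m => [_|m IH mn].
  exists rJ; split=> // k x; rewrite leqn0 => /eqP -> _.
  by rewrite /hankel /ldet det_mx00 oner_neq0.
have [r [r0 rJx rH]] := IH (ltnW mn).
have [Hm0|/near_right_interval[s s0 sH]] :=
    analytic_at_isolated (analytic_at_hankel m.+1 (fan 0 J0)); last first.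
  exists (Num.min r s); split; first by rewrite lt_min r0.
    by move=> x; rewrite lt_min => /and3P[x0 xr _]; apply: rJx; rewrite x0.
  move=> k x; rewrite lt_min leq_eqVlt => /orP[/eqP ->|km] /and3P[x0 xr xs].
    by apply: sH; rewrite x0.
  by apply: rH => //; rewrite x0.
have [s s0 sH] := near_right_interval (nbhs_dnbhs Hm0).
pose t := Num.min r s.
have t0 : 0 < t by rewrite lt_min r0.
have tr x : 0 < x < t -> 0 < x < r by rewrite lt_min => /and3P[-> ->].
have ts x : 0 < x < t -> 0 < x < s by rewrite lt_min => /and3P[-> _ ->].
have [b bE] := @hankel_ode R m f t (fun x xt => fan x (rJx x (tr x xt)))
  (fun x xt => sH x (ts x xt)) (fun x xt => rH m x (leqnn m) (tr x xt)).
(* If the determinant of size [m.+1] vanished near 0 while that of size [m] did not, the resulting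
   equation of order [m < n] for [f''] would make the differences dependent for these shifts. *)
have [d [d_inj dL]] := delta_dependent J_open J_itv fan t0 (fun x xt => rJx x (tr x xt)) mn L0 bE.
by have := ind d d_inj dL.
Qed.

Lemma sign_regular_kernelN n (r : R) f e : sign_regular_kernel n r f e ->
  sign_regular_kernel n r (fun x => - f x) (fun k => (-1) ^+ k * e k).
Proof.
move=> ker k d x kn d_incr d0 x_incr x0 xr.
rewrite (@eq_ldet _ _ _ (fun i l => -1 * (f (x l.+1 + d i) - f (x l.+1) - (f (x l + d i) - f (x l))))).
  rewrite ldet_scale [_ * e k]mulrC mulrA -[e k * _ * _]mulrA -expr2 sqrr_sign mulr1.
  exact: ker.
by move=> i l _ _; ring.
Qed.

Lemma local_kernel n f J (L : R) :
  open J -> is_interval J -> (forall x, J x -> analytic_at f x) -> J 0 -> 0 < L ->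
  (forall d : 'I_n.+1 -> R, injective d -> (forall i, 0 < d i < L) ->
     one_independent (Delta_dom J d) (fun i => Delta (d i) f)) ->
  exists r e (s : bool), [/\ 0 < r,
    sign_regular_kernel n.+1 r (fun x => (-1) ^+ s * f x) e &
    forall x y, 0 < x -> x < y -> y < r -> (-1) ^+ s * f x < (-1) ^+ s * f y].
Proof.
move=> J_open J_itv fan J0 L0 ind.
have [r [r0 rJ rH]] := hankel_radius J_open J_itv fan J0 L0 ind.
have [t [t0 tr t1]] : exists t, [/\ 0 < t, t <= r & forall x, 0 < x < t -> derive1 f x != 0].
  have [f10|/near_right_interval[s s0 sH]] :=
      analytic_at_isolated (analytic_at_derive1n 1 (fan 0 J0)); last first.
    exists (Num.min r s); rewrite lt_min r0 s0 ge_min lexx; split=> // x.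
    by rewrite lt_min => /and3P[x0 xr xs]; apply: sH; rewrite x0.
  (* If [f'] vanished near 0, so would [f''], which is the Hankel determinant of size 1. *)
  have [s s0 sH] := near_right_interval (nbhs_dnbhs f10).
  pose x := Num.min r s / 2.
  have xrs : 0 < x < Num.min r s.
    have m0 : 0 < Num.min r s by rewrite lt_min r0.
    by rewrite /x; lra.
  have [xr xs] : 0 < x < r /\ 0 < x < s.
    by move: xrs; rewrite lt_min => /and3P[-> -> ->].
  have openO : open [set x : R | 0 < x < s].
    rewrite (_ : mkset _ = `]0, s[%classic); first exact: interval_open.
    by apply/seteqP; split=> y /=; rewrite in_itv.
  have := rH 1%N x isT xr; rewrite /hankel ldet1.
  have -> : derive1n (0 + 0).+2 f x = derive1 (fun=> 0) x by exact: (derive1_ext openO sH xs).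
  by rewrite derive1_cst eqxx.
have rt x : 0 < x < t -> 0 < x < r by move=> xt; lra.
have fd x m : 0 < x < t -> derivable (derive1n m f) x 1.
  by move=> /rt /rJ /fan fx; apply/analytic_at_derivable/analytic_at_derive1n.
(* A continuous function without zeros keeps its sign, so the value at any one point can serve as
   sign. *)
pose e k := hankel k f (t / 2).
have t2 : 0 < t / 2 < t by lra.
have ker : sign_regular_kernel n.+1 t f e.
  apply: hankel_kernel => // k x /andP[_ kn] xt.
  apply: (@nonzero_same_sign (hankel k f) t) => // [y yt|y yt].
    exact/analytic_at_derivable/analytic_at_hankel/fan/rJ/rt.
  exact/rH/rt.
have f_sign := nonzero_same_sign (fun x => fd x 1%N) t1.
have mvt x y : 0 < x -> x < y -> y < t -> exists2 c, 0 < c < t & f y - f x = derive1 f c * (y - x).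
  move=> x0 xy yt; have [| |c] := @MVT R f (derive1 f) x y xy.
  - move=> z; rewrite in_itv /= => /andP[xz zy].
    by rewrite derive1E; apply: derivableP; apply: (fd z 0%N); lra.
  - apply: derivable_within_continuous => z; rewrite in_itv /= => /andP[xz zy].
    by apply: (fd z 0%N); lra.
  - by rewrite in_itv /= => /andP[xc cy] ->; exists c => //; lra.
have := t1 _ t2; rewrite neq_lt => /orP[neg|pos].
- exists t, (fun k => (-1) ^+ k * e k), true; split=> //.
    rewrite (_ : (fun x => _) = (fun x => - f x)); first exact: sign_regular_kernelN.
    by apply/funext => x; rewrite expr1 mulN1r.
  move=> x y x0 xy yt; have [c ct fE] := mvt x y x0 xy yt.
  rewrite expr1 !mulN1r ltrN2 -subr_lt0 fE nmulr_rlt0 ?subr_gt0 //.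
  by have := f_sign _ _ t2 ct; rewrite nmulr_rgt0.
- exists t, e, false; split=> //.
    rewrite (_ : (fun x => _) = f) //.
    by apply/funext => x; rewrite expr0 mul1r.
  move=> x y x0 xy yt; have [c ct fE] := mvt x y x0 xy yt.
  rewrite expr0 !mul1r -subr_gt0 fE pmulr_rgt0 ?subr_gt0 //.
  by have := f_sign _ _ t2 ct; rewrite pmulr_rgt0.
Qed.

End LocalKernel.

(** * The theorem *)

Section Final.
Variable R : realType.
Implicit Types (f : R -> R) (A B : {fset R}).

Lemma tuple_of_seq s (p : seq R) B : size p = s -> (forall x, x \in p -> x \in B) ->
  exists b : s.-tuple B, \sum_(i < s) fsval (tnth b i) = \sum_(x <- p) x.
Proof.
move=> <- pB; have pBi (i : 'I_(size p)) : nth 0 p i \in B by apply/pB/mem_nth.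
exists [tuple FSetSub (pBi i) | i < size p].
rewrite (big_nth 0) big_mkord; apply: eq_bigr => i _.
by rewrite tnth_mktuple.
Qed.

Lemma rep_sumdiff m B z : rep m (fun x => x \in B) z -> z \in sumdiff m.+1 m B.
Proof.
move=> [p [q [sp sq pB qB ->]]].
have [b <-] := tuple_of_seq sp pB; have [b' <-] := tuple_of_seq sq qB.
by apply/imfset2P; exists b => //; exists b'.
Qed.

(** The points are sorted into cells of length [r] by truncating [(x - a) / r], and the fullest cell
    is kept; [K] is the number of cells. *)
Lemma short_subset (a b r : R) : 0 < r -> exists2 K : nat, (0 < K)%N &
  forall A, [set` A] `<=` `[a, b] -> exists s : seq R,
    [/\ uniq s, (forall x, x \in s -> x \in A), (#|` A| <= K * size s)%N &
        forall x y, x \in s -> y \in s -> x - y < r].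
Proof.
move=> r0; pose t x := Num.truncn ((x - a) / r).
exists (t b).+1 => // A Aab.
have tP x : x \in A -> (t x)%:R <= (x - a) / r < (t x).+1%:R.
  move=> xA; apply: truncn_itv; rewrite divr_ge0 ?(ltW r0) // subr_ge0.
  by have := Aab x xA; rewrite /= in_itv => /andP[].
have tb x : x \in A -> (t x < (t b).+1)%N.
  move=> xA; rewrite ltnS; apply: le_truncn; rewrite ler_pM2r ?invr_gt0 // lerD2r.
  by have := Aab x xA; rewrite /= in_itv => /andP[].
have [//|i _ Ai] := @count_pigeonhole _ t (enum_fset A) predT (t b).+1 isT.
exists [seq x <- enum_fset A | t x == i]; split.
- by apply: filter_uniq; exact: fset_uniq.
- by move=> x; rewrite mem_filter => /andP[].
- rewrite size_filter (@eq_count _ (fun x => t x == i) (fun x => (t x == i) && predT x)).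
    by rewrite count_predT in Ai.
  by move=> x; rewrite andbT.
move=> x y; rewrite !mem_filter => /andP[/eqP tx xA] /andP[/eqP ty yA].
have /andP[_ h1] := tP x xA; have /andP[h2 _] := tP y yA.
rewrite tx ltr_pdivrMr // -natr1 in h1; rewrite ty ler_pdivlMr // in h2.
lra.
Qed.

Lemma ordered_enumeration (s : seq R) : uniq s ->
  exists u : nat -> R, [/\ (forall i j, (i < j < size s)%N -> u i < u j) &
    forall i, (i < size s)%N -> u i \in s].
Proof.
move=> us; pose v := sort <=%R s.
have sv : size v = size s by rewrite size_sort.
exists (nth 0 v); split=> [i j /andP[ij js]|i js].
  have v_lt : sorted <%R v by rewrite sort_lt_sorted.
  by rewrite (sorted_ltn_nth lt_trans) // inE sv // (ltn_trans ij).
by rewrite -(mem_sort <=%R) mem_nth // sv.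
Qed.

Lemma signed_rep m (s : bool) (X Y : R -> Prop) z :
  (forall x, X x -> Y ((-1) ^+ s * x)) -> rep m X z -> rep m Y ((-1) ^+ s * z).
Proof.
case: s => XY; last first.
  by rewrite expr0 mul1r; apply: rep_sub => x /XY; rewrite expr0 mul1r.
rewrite expr1 mulN1r => /repN; apply: rep_sub => x /XY.
by rewrite expr1 mulN1r opprK.
Qed.

End Final.

Theorem theorem1p10 (R : realType) (a b : R) (hab : a <= b)
  (n : nat) (hn : (0 < n)%N)
  (J : set R) (hJo : open J) (hJi : is_interval J) (hIJ : `[a, b] `<=` J)
  (f : R -> R) (hf : analytic_on J f)
  (hind : forall d : 'I_n -> R, injective d ->
     (forall i, 0 < d i < diam `[a, b]) ->
     one_independent (Delta_dom J d) (fun i => Delta (d i) f)) :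
  exists2 C : R, 0 < C &
    forall A : {fset R},
      [set` A] `<=` `[a, b] -> [set` diffset A] `<=` J ->
      C * (#|` A|%:R `^ (1 + phi R n)) <=
        #|` sumdiff (2 ^ n) (2 ^ n - 1) [fset f x | x in diffset A]%fset|%:R.
Proof.
case: n hn hind => // n _ hind.
have phi0 : 0 < 1 + phi R n.+1 by rewrite addr_gt0 // (lt_le_trans _ (phi_ge1 R n)).
set B := fun A : {fset R} => [fset f x | x in diffset A]%fset.
have BP (A : {fset R}) x y : x \in A -> y \in A -> f (x - y) \in B A.
  move=> xA yA; apply: in_imfset => /=.
  by apply/imfset2P; exists x => //; exists y.
have pow2 : (2 ^ n.+1)%N = ((2 ^ n.+1).-1).+1 by rewrite prednK // expn_gt0.
have repB (A : {fset R}) z : rep (2 ^ n.+1).-1 (fun x => x \in B A) z ->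
    z \in sumdiff (2 ^ n.+1) (2 ^ n.+1 - 1) (B A).
  by rewrite subn1 {2}pow2; exact: rep_sumdiff.
have diam_le : b - a <= diam `[a, b].
  apply: ub_le_sup; last first.
    exists b; first by rewrite /= in_itv /= lexx hab.
    by exists a; rewrite ?(ger0_norm, subr_ge0) //= in_itv /= lexx hab.
  exists (b - a) => _ [x + [y + <-]]; rewrite /= !in_itv /= => /andP[ax xb] /andP[ay yb].
  by rewrite ler_norml; lra.
have nonempty (A : {fset R}) : A != fset0 -> exists2 x, x \in A & 0 \in diffset A.
  move=> /fset0Pn[x xA]; exists x => //; apply/imfset2P.
  by exists x => //; exists x => //; rewrite subrr.
(* A nonempty [A] forces 0 into [A - A], hence into [J]. Outside the main case [A] is therefore
   empty or, when [a = b], a single point, and the constant 1 suffices. *)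
have [hJ0|hJ0] := pselect (J 0 /\ a < b); last first.
  exists 1 => // A Aab AJ; rewrite mul1r.
  have [->|A0] := eqVneq A fset0; first by rewrite cardfs0 powR0 ?gt_eqF.
  have [x xA dA] := nonempty A A0.
  have ab : a = b.
    apply/eqP; rewrite eq_le hab leNgt; apply/negP => ab; apply: hJ0; split=> //.
    exact: AJ.
  have -> : A = [fset x]%fset.
    apply/fsetP => y; rewrite in_fset1; apply/idP/eqP => [yA|->//].
    have := Aab x xA; have := Aab y yA; rewrite /= !in_itv /= -ab => yab xab.
    by apply/eqP; rewrite eq_le; lra.
  rewrite cardfs1 powR1 ler1n cardfs_gt0; apply/fset0Pn.
  exists (f (x - x)); apply: repB.
  have v : f (x - x) \in B [fset x]%fset by apply: BP; rewrite in_fset1.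
  exact: (rep_pad v _ (rep0 (X := fun y => y \in B [fset x]%fset) v)).
have [J0 ab] := hJ0.
have fan x : J x -> analytic_at f x by exact: analytic_on_at.
have L0 : 0 < diam `[a, b] by apply: lt_le_trans diam_le; rewrite subr_gt0.
have [r [e [s [r0 ker f_incr]]]] := local_kernel hJo hJi fan J0 L0 hind.
have [c c0 grow] := ordered_growth R n.
have [K K0 short] := short_subset a b r0.
have KR : 0 < K%:R :> R by rewrite ltr0n.
have KP : 0 < K%:R `^ (1 + phi R n.+1) by rewrite powR_gt0.
(* Passing to a short subset costs a factor [K] in cardinality, which enters with the exponent of
   the estimate. *)
exists (c / K%:R `^ (1 + phi R n.+1)); first exact: divr_gt0.
move=> A Aab AJ; have [t [ut tA At t_short]] := short A Aab.
have [st|st] := posnP (size t).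
  move: At; rewrite st muln0 leqn0 => /eqP ->.
  by rewrite powR0 ?gt_eqF // mulr0.
have [u [u_incr ut_in]] := ordered_enumeration ut.
have last_t : ((size t).-1 < size t)%N by rewrite prednK.
have [Z [uZ Zs Zrep]] := grow r _ e u (size t) st ker f_incr u_incr
  (t_short _ _ (ut_in _ last_t) (ut_in _ st)).
have AtR : #|` A|%:R `^ (1 + phi R n.+1) <=
    K%:R `^ (1 + phi R n.+1) * (size t)%:R `^ (1 + phi R n.+1) :> R.
  rewrite -powRM ?ler0n // ge0_ler_powR ?nnegrE ?(ltW phi0) ?mulr_ge0 ?ler0n //.
  by rewrite -natrM ler_nat.
apply: (@le_trans _ _ (c * (size t)%:R `^ (1 + phi R n.+1))).
  apply: (le_trans (ler_wpM2l _ AtR)); first by rewrite divr_ge0 ?ltW.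
  by rewrite mulrA divfK // gt_eqF.
apply: (le_trans Zs); rewrite ler_nat -(size_map (fun z => (-1) ^+ s * z)).
apply: uniq_leq_size.
  by rewrite map_inj_uniq //; apply: mulfI; rewrite signr_eq0.
move=> _ /mapP[z /Zrep zrep ->]; apply: repB.
apply: (signed_rep _ zrep) => _ [i [j [it jt ->]]].
by rewrite mulrA -expr2 sqrr_sign mul1r; apply: BP; apply/tA/ut_in.
Qed.
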